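(* Let $n \geq 4$ and let $I \subseteq \{1,\ldots,n\}$ satisfy the (NG)-condition. Let $R$ be an integral domain which is either of characteristic zero, or of the form $R=\mathbb{F}_q[t,f_1(t)^{-1},\ldots,f_{\ell-1}(t)^{-1}]$, where $q$ is a prime power, $\ell \geq 2$, and $f_1(t),\ldots,f_{\ell-1}(t)\in \mathbb{F}_q[t]$ are monic irreducible and pairwise coprime. If $\mathbf{S}^I_n(R)$ is finitely generated, then $\mathbf{S}^I_n(R)$ has property $R_\infty$.
   Context: For a group $G$ and $\varphi\in\mathrm{Aut}(G)$, two elements $g,h\in G$ are $\varphi$-twisted conjugate if $g=xh\varphi(x)^{-1}$ for some $x\in G$; the number of equivalence classes is the Reidemeister number $R(\varphi)\in\mathbb{Z}_{>0}\cup\{\infty\}$. A group $G$ has property $R_\infty$ if $R(\varphi)=\infty$ for every $\varphi\in\mathrm{Aut}(G)$. For a commutative unital ring $R$ with unit group $U(R)$, an integer $n\ge 2$ and $I\subseteq\{1,\ldots,n\}$, $\mathbf{S}^I_n(R)\le \mathrm{GL}_n(R)$ is the group of all upper triangular $n\times n$ matrices over $R$ whose diagonal entries lie in $U(R)$ and whose $j$-th diagonal entry equals $1$ for every $j\notin I$. A set $I\subseteq\{1,\ldots,n\}$ satisfies the (NG)-condition if for every $i\in\{1,\ldots,n-1\}$, $i\notin I$ implies $i+1\in I$. *)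

(* Defs.v *)
From HB Require Import structures.
From mathcomp Require Import all_boot all_order all_algebra.
Set Implicit Arguments. Unset Strict Implicit. Unset Printing Implicit Defensive.
Import Order.TTheory GRing.Theory Num.Theory.
Local Open Scope ring_scope.

(* Indices are 0-based: 'I_n = {0,...,n-1} stands for {1,...,n}. *)

Definition NG_condition (n : nat) (I : {set 'I_n}) : Prop :=
  forall i j : 'I_n, nat_of_ord j = (nat_of_ord i).+1 -> i \notin I -> j \in I.

Definition inSI (R : comUnitRingType) (n : nat) (I : {set 'I_n})
  (A : 'M[R]_n) : Prop :=
  [/\ forall i j : 'I_n, (j < i)%N -> A i j = 0,
      forall i : 'I_n, A i i \is a GRing.unit
    & forall i : 'I_n, i \notin I -> A i i = 1].

Inductive gen_by (R : comUnitRingType) (n : nat) (s : seq 'M[R]_n)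
  : 'M[R]_n -> Prop :=
| gen_one : gen_by s 1%:M
| gen_elt x : x \in s -> gen_by s x
| gen_mul x y : gen_by s x -> gen_by s y -> gen_by s (x *m y)
| gen_inv x : gen_by s x -> gen_by s (invmx x).

Definition SI_fin_gen (R : comUnitRingType) (n : nat) (I : {set 'I_n}) : Prop :=
  exists s : seq 'M[R]_n,
    (forall x, x \in s -> inSI I x) /\ (forall A, inSI I A -> gen_by s A).

(* phi is an automorphism of the group S^I_n(R) (represented by a function
   on matrices whose restriction to S^I_n(R) is a bijective homomorphism). *)
Definition SI_aut (R : comUnitRingType) (n : nat) (I : {set 'I_n})
  (phi : 'M[R]_n -> 'M[R]_n) : Prop :=
  [/\ forall A, inSI I A -> inSI I (phi A),
      forall A B, inSI I A -> inSI I B -> phi A = phi B -> A = B,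
      forall B, inSI I B -> exists2 A, inSI I A & phi A = B
    & forall A B, inSI I A -> inSI I B -> phi (A *m B) = phi A *m phi B].

Definition twisted_conj (R : comUnitRingType) (n : nat) (I : {set 'I_n})
  (phi : 'M[R]_n -> 'M[R]_n) (g h : 'M[R]_n) : Prop :=
  exists2 x, inSI I x & g = x *m h *m invmx (phi x).

Definition reidemeister_infinite (R : comUnitRingType) (n : nat)
  (I : {set 'I_n}) (phi : 'M[R]_n -> 'M[R]_n) : Prop :=
  ~ exists s : seq 'M[R]_n,
      (forall x, x \in s -> inSI I x) /\
      (forall g, inSI I g -> exists2 h, h \in s & twisted_conj I phi g h).

Definition SI_R_infty (R : comUnitRingType) (n : nat) (I : {set 'I_n}) : Prop :=
  forall phi : 'M[R]_n -> 'M[R]_n, SI_aut I phi -> reidemeister_infinite I phi.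

(* R is (isomorphic to) F_q[t, f_1^-1, ..., f_{l-1}^-1], l >= 2, with the f_i
   monic irreducible pairwise coprime: there is an injective ring morphism
   iota : F_q[t] -> R sending each f_i to a unit, such that every element of R
   has the form iota(p) / iota(f_1 ... f_{l-1})^k. *)
Definition is_Fq_localization (R : idomainType) : Prop :=
  exists (F : finFieldType) (f : seq {poly F}) (iota : {rmorphism {poly F} -> R}),
    [/\ (1 <= size f)%N /\
          (forall g, g \in f -> g \is monic /\ irreducible_poly g),
        forall i j : nat, (i < size f)%N -> (j < size f)%N -> i <> j ->
          coprimep f`_i f`_j,
        injective iota,
        forall g, g \in f -> iota g \is a GRing.unit
      & forall r : R, exists (p : {poly F}) (k : nat),
          r * iota ((\prod_(g <- f) g) ^+ k) = iota p].

(* Main.v *)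
Require Import Defs.
From HB Require Import structures.
From mathcomp Require Import all_boot all_order all_algebra all_field.
From mathcomp Require Import boolp zify ring.
Set Implicit Arguments. Unset Strict Implicit. Unset Printing Implicit Defensive.
Import Order.TTheory GRing.Theory Num.Theory.
Local Open Scope ring_scope.

(** Let N be the group of matrices of S with constant diagonal, that is, the
    Engel elements of S. The centralizer in N of the second center of N is
    { x in N | x_{1,2} = x_{n-1,n} = 0 }, so an automorphism phi acts on the
    quotient R^2 of N. As n >= 4, condition (NG) makes the two characters by
    which S acts on this quotient independent, and comparing stabilizers shows
    that phi preserves or exchanges the two coordinates. The commutator pairing
    of this quotient with the second center, whose values lie in the center, is
    multiplication in R; hence on each coordinate phi is x |-> a * tau x with a
    a unit and tau a ring automorphism. Projecting to one affine group
    R x| U(R) (after composing the two coordinates when they are exchanged), a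
    finite Reidemeister number yields a ring automorphism rho of R with
    finite cokernels of 1 - rho on U(R) and, twisting by a suitable unit, on R.

    S is finitely generated, hence so is the ring R, and R is residually
    finite through quotients stable under all ring automorphisms. In a finite
    quotient the kernel and the cokernel of 1 - rho have the same order, so
    rho has finitely many fixed points. This is absurd in characteristic zero
    because of the integers. In the localized case rho permutes the finitely
    many fractions of degree at most one, so it has finite order on t, and the
    product over the orbit of a nonunit defined over the prime field has
    infinitely many powers. *)

(** * Homomorphisms from finitely generated domains to finite fields *)

Lemma finField_ext_root (K : finFieldType) (p : {poly K}) :
  (1 < size p)%N ->
  exists (L : finFieldType) (j : {rmorphism K -> L}) (z : L),
    root (map_poly j p) z.
Proof.
move=> sp; have p0 : p != 0 by rewrite -size_poly_gt0 (ltn_trans _ sp).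
have [L [zs Dp _]] := FinSplittingFieldFor p0.
have : (1 < size (map_poly (GRing.in_alg L) p))%N by rewrite size_map_poly.
case: zs Dp => [|z zs] Dp sp1.
  by move: Dp sp1 => /eqp_size ->; rewrite big_nil size_poly1.
exists (FinFieldExtType L), (GRing.in_alg L), z.
have -> : root (map_poly (GRing.in_alg L) p) z by
  rewrite (eqp_root Dp) big_cons rootM root_XsubC eqxx.
by [].
Qed.

Section Hom.
Variable R : idomainType.

(* Injectivity of [i] is not required, so that iterated polynomial rings over
   int can play the role of the finitely generated subrings of R. *)
Definition finite_points (A : comNzRingType) (i : {rmorphism A -> R}) : Prop :=
  forall c : A, i c != 0 ->
  exists (K : finFieldType) (h : {rmorphism A -> K}),
    (forall x, i x = 0 -> h x = 0) /\ h c != 0.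


(** In characteristic p reduce modulo p; in characteristic zero reduce modulo a prime larger than
    the absolute value of [c]. *)
Lemma finite_points_int : finite_points (intr : {rmorphism int -> R}).
Proof.
have intr0 (S : nzRingType) (x : int) : (x%:~R == 0 :> S) = (`|x|%N%:R == 0 :> S).
  by case: x => // k; rewrite NegzE mulrNz oppr_eq0.
have pointFp (p : nat) (c : int) : prime p ->
    (forall x : int, x%:~R = 0 :> R -> (p %| `|x|)%N) -> ~~ (p %| `|c|)%N ->
  exists (K : finFieldType) (h : {rmorphism int -> K}),
    (forall x : int, x%:~R = 0 :> R -> h x = 0) /\ h c != 0.
  move=> pp ker pc; have Fp := pchar_Fp pp.
  exists 'F_p, (intr : {rmorphism int -> 'F_p}); split => [x /ker px|].
    by apply/eqP; rewrite intr0 -(dvdn_pcharf Fp).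
  by rewrite intr0 -(dvdn_pcharf Fp).
move=> c; rewrite intr0 => c0.
case: (EM (exists p, p \in [pchar R])) => [[p ch]|ch].
  apply: (pointFp p); first exact: pcharf_prime ch.
    by move=> x /eqP; rewrite intr0 (dvdn_pcharf ch).
  by rewrite (dvdn_pcharf ch).
have /pcharf0P ch0 : [pchar R] =i pred0.
  by move=> p; apply/negbTE/negP => H; apply: ch; exists p.
move: c0; rewrite ch0 => c0.
have [p pc pp] := prime_above `|c|%N; apply: (pointFp p) => //.
  by move=> x /eqP; rewrite intr0 ch0 => /eqP ->.
by rewrite gtnNdvd // lt0n.
Qed.

(** [i] may kill leading coefficients. After truncation the leading coefficient survives, as the
    pseudo-divisions below require. *)
Lemma truncate_lead (A : comNzRingType) (i : {rmorphism A -> R}) (P : {poly A}) :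
  map_poly i P != 0 ->
  exists Q, [/\ map_poly i Q = map_poly i P, size Q = size (map_poly i P)
    & i (lead_coef Q) != 0].
Proof.
move=> P0; set n := size (map_poly i P).
have n0 : (0 < n)%N by rewrite size_poly_gt0.
have lP : i P`_n.-1 != 0 by rewrite -coef_map -lead_coefE lead_coef_eq0.
have lP' : P`_n.-1 != 0 by apply: contraNneq lP => ->; rewrite rmorph0.
exists (\poly_(j < n) P`_j); split.
- apply/polyP => j; rewrite !coef_map coef_poly; case: ltnP => // nj.
  by rewrite raddf0 -coef_map nth_default.
- by rewrite size_poly_eq.
- by rewrite lead_coef_poly.
Qed.

(** Inductive step of a Nullstellensatz. If [b] is transcendental over the image of [A], a point
    keeping some coefficient of [C] extends. Otherwise let [F] be a relation of least degree: a
    Bezout relation [U * C + V * F = a] over [R], with [a] a nonzero constant, leaves only a point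
    of [A] keeping [a] and the leading coefficient of [F] to be found. *)
Lemma finite_points_poly (A : comNzRingType) (i : {rmorphism A -> R}) (b : R) :
  finite_points i ->
  finite_points (horner_eval b \o map_poly i : {rmorphism {poly A} -> R}).
Proof.
move=> fpA C; set e : {rmorphism {poly A} -> R} := (_ \o _ : {rmorphism _ -> _}).
have eE P : e P = (map_poly i P).[b] by [].
have eC x : e x%:P = i x by rewrite eE map_polyC hornerC.
move=> C0.
have hker (L : finFieldType) (h : {rmorphism A -> L}) (z : L) P :
    (forall x, i x = 0 -> h x = 0) -> map_poly i P = 0 -> map_poly h P = 0.
  move=> ker P0; apply/polyP => k; rewrite coef_map coef0; apply: ker.
  by rewrite -coef_map P0 coef0.
pose bad n := `[< exists F : {poly A},
   [/\ map_poly i F != 0, e F = 0 & size (map_poly i F) = n] >].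
have [exF|tr] := pselect (exists n, bad n); last first.
  have {}tr P : e P = 0 -> map_poly i P = 0.
    move=> eP; apply/eqP/negPn/negP => P0; apply: tr.
    by exists (size (map_poly i P)); apply/asboolP; exists P.
  have Ci : map_poly i C != 0.
    by apply: contraNneq C0; rewrite eE => ->; rewrite horner0.
  have {}Ci : i (C`_(size (map_poly i C)).-1) != 0.
    by rewrite -coef_map -lead_coefE lead_coef_eq0.
  have [K [h [ker hC]]] := fpA _ Ci.
  have Ch : map_poly h C != 0.
    apply: contraNneq hC => Ch0; rewrite -coef_map Ch0 coef0 //.
  (* A root [z] of [C * 'X - 1] satisfies [C(z) * z = 1], so [C] does not vanish at [z]. *)
  have [|L [j [z]]] := @finField_ext_root K (map_poly h C * 'X - 1).
    by rewrite size_polyDl size_mulX // ?size_polyN ?size_poly1 // ltnS size_poly_gt0.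
  rewrite rmorphB rmorphM /= map_polyX rmorph1 rootE !hornerE subr_eq0 => /eqP Hz.
  pose h' : {rmorphism {poly A} -> L} :=
    (horner_eval z \o (map_poly j \o map_poly h) : {rmorphism _ -> _}).
  exists L, h'; split => [P /tr P0|].
    by rewrite /h' /= (hker _ _ 0 _ ker P0) /= rmorph0 /= /horner_eval horner0.
  apply: contraTneq isT => hC'; move: Hz; move: hC'; rewrite /h' /= /horner_eval => ->.
  by rewrite mul0r => /esym/eqP; rewrite oner_eq0.
case: (ex_minnP exF) => n /asboolP[F0 [F0i eF0 sF0]] minF.
have [F [FF0 sF lF]] := truncate_lead F0i.
have eF : e F = 0 by rewrite eE FF0.
rewrite sF0 in sF.
have Fi : map_poly i F != 0 by rewrite FF0.
have Fn0 : F != 0 by apply: contraNneq Fi => ->; rewrite rmorph0.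
have smin P : e P = 0 -> (size P < n)%N -> map_poly i P = 0.
  move=> eP sP; apply/eqP/negPn/negP => P0.
  suff : (n <= size P)%N by rewrite leqNgt sP.
  apply: leq_trans (size_poly _ _); apply: minF.
  by apply/asboolP; exists P.
have n2 : (1 < n)%N.
  rewrite ltnNge; apply/negP => n1.
  move: eF lF; rewrite eE [F]size1_polyC ?sF // map_polyC hornerC lead_coefC => ->.
  by rewrite eqxx.
(* A combination of [C] and [F] of least size not vanishing at [b] will be shown to be a
   constant. *)
pose comb n := `[< exists H U V : {poly A}, [/\ e H != 0,
   map_poly i H = map_poly i (U * C + V * F) & size (map_poly i H) = n] >].
have exH : exists n, comb n.
  exists (size (map_poly i C)); apply/asboolP; exists C, 1, 0; split => //.
  by rewrite mul1r mul0r addr0.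
case: (ex_minnP exH) => m /asboolP[H0 [U [V [eH0 HUV sH0]]]] minH.
have H0i : map_poly i H0 != 0 by apply: contraNneq eH0; rewrite eE => ->; rewrite horner0.
have [H [HH0 sH lH]] := truncate_lead H0i.
rewrite sH0 in sH; rewrite -HH0 in HUV.
have eH : e H != 0 by rewrite eE HH0 -eE.
have Hn0 : H != 0 by apply: contraNneq eH => ->; rewrite rmorph0.
have hmin P U' V' : e P != 0 -> map_poly i P = map_poly i (U' * C + V' * F) -> (m <= size P)%N.
  move=> eP PUV; apply: leq_trans (size_poly _ _); apply: minH.
  by apply/asboolP; exists P, U', V'.
have mn : (m < n)%N.
  set S := Pdiv.Ring.rmodp H F.
  have /= := Pdiv.ComRing.rdivp_eq F H; set k := Pdiv.Ring.rscalp _ _.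
  set Q := Pdiv.Ring.rdivp _ _; rewrite -/S -mul_polyC => E.
  have SE : S = (lead_coef F ^+ k)%:P * H - Q * F by rewrite E addrC addKr.
  apply: leq_ltn_trans (_ : size S < n)%N; last by rewrite -sF Pdiv.Ring.ltn_rmodpN0.
  apply: (hmin _ ((lead_coef F ^+ k)%:P * U) ((lead_coef F ^+ k)%:P * V - Q)).
    rewrite SE rmorphB !rmorphM eF mulr0 subr0 mulf_neq0 //.
    by rewrite eC rmorphXn expf_neq0.
  by rewrite SE rmorphB !rmorphM /= HUV -!rmorphM -rmorphB /=; congr map_poly; ring.
(* The remainder of [F] by [H] vanishes at [b] by minimality of [m], hence is zero over [R] by
   minimality of [n]. The quotient then vanishes at [b] and has size at least [n], which leaves size
   one for [H]. *)
have m1 : m = 1%N.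
  set S := Pdiv.Ring.rmodp F H.
  have /= := Pdiv.ComRing.rdivp_eq H F; set k := Pdiv.Ring.rscalp _ _.
  set Q := Pdiv.Ring.rdivp _ _; rewrite -/S -mul_polyC => E.
  have SE : S = (lead_coef H ^+ k)%:P * F - Q * H by rewrite E addrC addKr.
  have sS : (size S < m)%N by rewrite -sH Pdiv.Ring.ltn_rmodpN0.
  have eS : e S = 0.
    apply/eqP/negPn/negP => eS; suff : (m <= size S)%N by rewrite leqNgt sS.
    apply: (hmin _ (- Q * U) ((lead_coef H ^+ k)%:P - Q * V)) => //.
    by rewrite SE rmorphB !rmorphM /= HUV -!rmorphM -rmorphB /=; congr map_poly; ring.
  have Si : map_poly i S = 0 by apply: smin => //; apply: ltn_trans sS mn.
  have eQ : e Q = 0.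
    move: eS; rewrite SE rmorphB !rmorphM eF mulr0 sub0r => /eqP.
    by rewrite oppr_eq0 mulf_eq0 (negbTE eH) orbF => /eqP.
  have Ei : map_poly i ((lead_coef H ^+ k)%:P * F) = map_poly i Q * map_poly i H.
    by rewrite E rmorphD rmorphM /= Si addr0.
  have lHk : i (lead_coef H ^+ k) != 0 by rewrite rmorphXn expf_neq0.
  have sE : size (map_poly i Q * map_poly i H) = n.
    by rewrite -Ei rmorphM /= map_polyC mul_polyC size_scale // FF0 sF0.
  have QH0 : map_poly i Q * map_poly i H != 0.
    by rewrite -size_poly_eq0 sE; apply/eqP => n0; rewrite n0 in n2.
  move: (QH0); rewrite mulf_eq0 => /norP[Qi Hi].
  have nQ : (n <= size (map_poly i Q))%N.
    by apply: minF; apply/asboolP; exists Q.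
  move: sE; rewrite size_mul // HH0 sH0 => sE.
  apply/eqP; rewrite eqn_leq; apply/andP; split; last by rewrite -sH0 size_poly_gt0.
  by move: nQ sE n2; clear; lia.
have Ha : H = (H`_0)%:P by apply: size1_polyC; rewrite sH m1.
set a := H`_0 in Ha.
have ia : i a != 0 by move: eH; rewrite Ha eE map_polyC hornerC.
have iaf : i (a * lead_coef F) != 0 by rewrite rmorphM mulf_neq0.
have [K [h [ker]]] := fpA _ iaf.
rewrite rmorphM mulf_eq0 negb_or => /andP[ha hf].
have Fh0 : size (map_poly h F) = n by rewrite -sF size_map_poly_id0.
have [|L [j [z]]] := @finField_ext_root K (map_poly h F); first by rewrite Fh0.
rewrite rootE => /eqP Fz.
pose h' : {rmorphism {poly A} -> L} :=
  (horner_eval z \o (map_poly j \o map_poly h) : {rmorphism _ -> _}).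
have h'0 P : map_poly i P = 0 -> h' P = 0.
  by move=> P0; rewrite /h' /= (hker _ _ 0 _ ker P0) /= rmorph0 /horner_eval horner0.
have h'F : h' F = 0 by [].
have h'C x : h' x%:P = j (h x) by rewrite /h' /= !map_polyC /horner_eval hornerC.
(* Up to a remainder that dies in [R], a power of [lead_coef F] times [P] is a multiple of [F], and
   that power survives under [h]. *)
exists L, h'; split => [P eP|].
  set S := Pdiv.Ring.rmodp P F.
  have /= := Pdiv.ComRing.rdivp_eq F P; set k := Pdiv.Ring.rscalp _ _.
  set Q := Pdiv.Ring.rdivp _ _; rewrite -/S -mul_polyC => E.
  have sS : (size S < n)%N by rewrite -sF Pdiv.Ring.ltn_rmodpN0.
  have SE : S = (lead_coef F ^+ k)%:P * P - Q * F by rewrite E addrC addKr.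
  have eS : e S = 0 by rewrite SE rmorphB !rmorphM eF eP !mulr0 subr0.
  have /(congr1 h') := E; rewrite rmorphM rmorphD rmorphM h'F mulr0 add0r.
  rewrite (h'0 _ (smin _ eS sS)) h'C => /eqP.
  by rewrite mulf_eq0 fmorph_eq0 rmorphXn expf_eq0 (negbTE hf) andbF => /eqP.
have : h' (H - (U * C + V * F)) = 0 by apply: h'0; rewrite rmorphB /= HUV subrr.
rewrite rmorphB rmorphD !rmorphM h'F mulr0 addr0 Ha h'C => /eqP.
rewrite subr_eq0 => /eqP E; apply: contraNneq ha => hC0.
by move/eqP: E; rewrite hC0 mulr0 fmorph_eq0.
Qed.
End Hom.

Inductive ring_gen (R : nzRingType) (gs : seq R) : R -> Prop :=
| ring_gen1 : ring_gen gs 1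
| ring_gen_mem x : x \in gs -> ring_gen gs x
| ring_genB x y : ring_gen gs x -> ring_gen gs y -> ring_gen gs (x - y)
| ring_genM x y : ring_gen gs x -> ring_gen gs y -> ring_gen gs (x * y).

Section FinitePoints.
Variables (R : idomainType) (gs : seq R).
Hypothesis genR : forall r : R, ring_gen gs r.

Lemma exists_poly_cover (s : seq R) :
  exists (A : comNzRingType) (i : {rmorphism A -> R}),
    finite_points i /\ forall g, g \in s -> exists a, i a = g.
Proof.
elim: s => [|b s [A [i [fpi cov]]]].
  by exists int, (intr : {rmorphism int -> R}); split => //; apply: finite_points_int.
exists {poly A}, (horner_eval b \o map_poly i : {rmorphism {poly A} -> R}).
split=> [|g]; first exact: finite_points_poly.
rewrite inE => /predU1P[-> | /cov[a <-]].
  by exists 'X; rewrite /= map_polyX /horner_eval hornerX.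
by exists a%:P; rewrite /= map_polyC /horner_eval hornerC.
Qed.

(** A point of the covering polynomial ring that kills the kernel of the map to [R] descends to [R]
    through any section. *)
Lemma finite_point (c : R) : c != 0 ->
  exists (K : finFieldType) (h : {rmorphism R -> K}), h c != 0.
Proof.
move=> c0; have [A [i [fpi cov]]] := exists_poly_cover gs.
have surj r : exists a, i a = r.
  elim: (genR r) => [|x /cov//|x y _ [a <-] _ [b <-]|x y _ [a <-] _ [b <-]].
  - by exists 1; rewrite rmorph1.
  - by exists (a - b); rewrite rmorphB.
  - by exists (a * b); rewrite rmorphM.
pose g r := projT1 (cid (surj r)); have gK r : i (g r) = r := projT2 (cid (surj r)).
have [|K [h [ker hc]]] := fpi (g c); first by rewrite gK.
have hE x y : i x = i y -> h x = h y.
  by move=> E; apply/eqP; rewrite -subr_eq0 -rmorphB ker // rmorphB E subrr.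
have hB : {morph h \o g : x y / x - y}.
  by move=> x y /=; rewrite -rmorphB; apply: hE; rewrite rmorphB !gK.
have hM : {morph h \o g : x y / x * y}.
  by move=> x y /=; rewrite -rmorphM; apply: hE; rewrite rmorphM !gK.
have h1 : (h \o g) 1 = 1.
  by rewrite /= -(rmorph1 h); apply: hE; rewrite rmorph1 gK.
pose hR : {rmorphism R -> K} := HB.pack_for {rmorphism R -> K} (h \o g)
  (GRing.isZmodMorphism.Build _ _ (h \o g) hB)
  (GRing.isMonoidMorphism.Build _ _ (h \o g) (h1, hM)).
by exists K, hR.
Qed.

(** A morphism to [K] is determined by its values on [gs], so there are finitely many. The quotient
    by all of them at once is finite and stable under every ring endomorphism. *)
Lemma finite_point_quotient (K : finFieldType) :
  exists (X : finType) (q : R -> X),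
    forall x y, q x = q y <-> forall h : {rmorphism R -> K}, h x = h y.
Proof.
pose good (z : (size gs).-tuple K) (h : {rmorphism R -> K}) := map h gs = z.
pose q r : {ffun (size gs).-tuple K -> K} := [ffun z =>
  if pselect (exists h, good z h) is left H then projT1 (cid H) r else 0].
exists {ffun (size gs).-tuple K -> K}, q => x y; split => [E h|E].
  have zP : good (map_tuple h (in_tuple gs)) h by [].
  have := congr1 (fun f : {ffun _ -> K} => f (map_tuple h (in_tuple gs))) E.
  rewrite !ffunE; case: pselect => [H|[]]; last by exists h.
  case: (cid H) => h' /= h'P.
  suff hh r : h' r = h r by rewrite !hh.
  elim: (genR r) => [|a ags|a b _ IHa _ IHb|a b _ IHa _ IHb].
  - by rewrite !rmorph1.
  - move: h'P; rewrite /good /= => Emap.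
    have := congr1 (fun s => nth 0 s (index a gs)) Emap.
    by rewrite !(nth_map 0) ?index_mem // nth_index.
  - by rewrite !rmorphB IHa IHb.
  - by rewrite !rmorphM IHa IHb.
by apply/ffunP => z; rewrite !ffunE; case: pselect.
Qed.
End FinitePoints.

(** * Fixed points and cokernels *)

(** An endomorphism of a finite abelian group has kernel and cokernel of the same order. Here [S] is
    the group and [T] the image of the map induced by [D]; [ks] embeds in the kernel and [ls] covers
    the cokernel. Abstract [mul] and [D] serve both the additive group and the units. *)
Lemma leq_size_kernel_cokernel (A : eqType) (X : finType) (q : A -> X) (P : A -> Prop)
    (mul : A -> A -> A) (D : A -> A) (ks ls : seq A) (a0 : A) :
  P a0 ->
  (forall a k, P a -> k \in ks -> P (mul a k)) ->
  (forall a b, P a -> P b -> q a = q b -> q (D a) = q (D b)) ->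
  (forall a k, P a -> k \in ks -> q (D (mul a k)) = q (D a)) ->
  (forall a k k', P a -> k \in ks -> k' \in ks ->
     q (mul a k) = q (mul a k') -> k = k') ->
  (forall x y l, q x = q y -> q (mul x l) = q (mul y l)) ->
  (forall a, P a -> exists b l, [/\ P b, l \in ls & a = mul (D b) l]) ->
  uniq ks -> (size ks <= size ls)%N.
Proof.
move=> Pa0 PM qD qDk kinj qM cov Uks.
pose S := [set x | `[< exists a, P a /\ q a = x >]].
have /choice [s sP] x : exists a, x \in S -> P a /\ q a = x.
  case: (boolP (x \in S)) => [|_]; last by exists a0.
  by rewrite inE => /asboolP[a aP]; exists a.
pose g x := q (D (s x)); pose T := g @: S.
have /choice [t tP] y : exists a, y \in T -> P a /\ q (D a) = y.
  case: (boolP (y \in T)) => [/imsetP[x xS ->]|_]; last by exists a0.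
  by exists (s x) => _; have [] := sP _ xS.
have T0 : (0 < #|T|)%N.
  apply/card_gt0P; exists (g (q a0)); apply/imsetP; exists (q a0) => //.
  by rewrite inE; apply/asboolP; exists a0.
have le1 : (#|T| * size ks <= #|S|)%N.
  pose w := [seq q (mul (t y) k) | y <- enum T, k <- ks].
  have -> : (#|T| * size ks)%N = size w by rewrite size_allpairs -cardE.
  have Uw : uniq w.
    apply: allpairs_uniq => //; first exact: enum_uniq.
    move=> _ _ /allpairsP[[y k] [/= yT kk ->]] /allpairsP[[y' k'] [/= yT' kk' ->]] /= E.
    move: yT yT'; rewrite !mem_enum => /tP[Pt Et] /tP[Pt' Et'].
    have yy : y = y'.
      rewrite -Et -Et' -(qDk (t y) k) // -(qDk (t y') k') //.
      by apply: qD => //; apply: PM.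
    by move: E Pt' ; rewrite -yy => /kinj -> // _.
  rewrite -(card_uniqP Uw); apply/subset_leq_card/subsetP => x.
  case/allpairsP => [[y k] [/=]]; rewrite mem_enum => /tP[Pt _] kk ->.
  by rewrite inE; apply/asboolP; exists (mul (t y) k); split => //; apply: PM.
have le2 : (#|S| <= #|T| * size ls)%N.
  pose w := [seq q (mul (D (t y)) l) | y <- enum T, l <- ls].
  have -> : (#|T| * size ls)%N = size w by rewrite size_allpairs -cardE.
  apply: leq_trans (card_size w); apply/subset_leq_card/subsetP => x xS.
  have [Ps Es] := sP _ xS; have [b [l [Pb lls Eb]]] := cov _ Ps.
  have bS : q b \in S by rewrite inE; apply/asboolP; exists b.
  have yT : g (q b) \in T by apply/imsetP; exists (q b).
  apply/allpairsP; exists (g (q b), l); rewrite mem_enum; split => //=.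
  rewrite -Es Eb; apply: qM; rewrite (proj2 (tP _ yT)); apply: qD => //.
    by have [] := sP _ bS.
  by have [] := sP _ bS.
by have := leq_trans le1 le2; rewrite leq_pmul2l.
Qed.

Section FixedPoints.
Variables (R : idomainType) (gs : seq R).
Hypothesis genR : forall r : R, ring_gen gs r.
Variable rho : {rmorphism R -> R}.

Lemma separate_seq (ks : seq R) :
  exists (K : finFieldType) (h : {rmorphism R -> K}), {in ks &, injective h}.
Proof.
pose c := \prod_(x <- [seq k - k' | k <- ks, k' <- ks] | x != 0) x.
have c0 : c != 0 by rewrite prodf_seq_neq0; apply/allP => x _; apply/implyP.
have [K [h hc]] := finite_point genR c0.
exists K, h => x y xk yk E; apply/eqP; rewrite -subr_eq0.
apply: contraNT hc => xy.
rewrite rmorph_prod prodf_seq_eq0; apply/hasP; exists (x - y).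
  by apply/allpairsP; exists (x, y).
by rewrite xy rmorphB E subrr eqxx.
Qed.

Lemma fixed_le_coker_add (ls ks : seq R) :
  (forall r, exists y l, l \in ls /\ r = y - rho y + l) ->
  uniq ks -> (forall k, k \in ks -> rho k = k) -> (size ks <= size ls)%N.
Proof.
move=> cov Uks fks; have [K [h0 h0inj]] := separate_seq ks.
have [X [q qP]] := finite_point_quotient genR K.
apply: (@leq_size_kernel_cokernel _ X q (fun _ => True) +%R (fun y => y - rho y) _ _ 0) => //.
- move=> a b _ _ /qP E; apply/qP => h; rewrite !rmorphB E.
  by congr (_ - _); apply: (E (h \o rho : {rmorphism R -> K})).
- by move=> a k _ kk; rewrite rmorphD (fks k) // opprD addrACA subrr addr0.
- move=> a k k' _ kk kk' /qP /(_ h0); rewrite !rmorphD => /addrI; exact: (h0inj k k' kk kk').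
- by move=> x y l /qP E; apply/qP => h; rewrite !rmorphD E.
- by move=> a _; have [y [l [ll ->]]] := cov a; exists y, l.
Qed.

Lemma fixed_le_coker_unit (ls ks : seq R) :
  (forall w, w \is a GRing.unit ->
     exists v l, [/\ v \is a GRing.unit, l \in ls & w = v / rho v * l]) ->
  uniq ks -> (forall k, k \in ks -> k \is a GRing.unit /\ rho k = k) ->
  (size ks <= size ls)%N.
Proof.
move=> cov Uks fks; have [K [h0 h0inj]] := separate_seq ks.
have [X [q qP]] := finite_point_quotient genR K.
have hV (h : {rmorphism R -> K}) x : x \is a GRing.unit -> h x^-1 = (h x)^-1.
  exact: rmorphV.
apply: (@leq_size_kernel_cokernel _ X q (fun x => x \is a GRing.unit) *%R
  (fun y => y / rho y) _ _ 1) => //.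
- exact: unitr1.
- by move=> a k Ua /fks[Uk _]; rewrite unitrM Ua.
- move=> a b Ua Ub /qP E; apply/qP => h; rewrite !rmorphM !hV ?rmorph_unit // E.
  by congr (_ / _); apply: (E (h \o rho : {rmorphism R -> K})).
- move=> a k Ua /fks[Uk fk]; rewrite rmorphM fk invrM ?rmorph_unit //.
  by rewrite mulrA mulrK.
- move=> a k k' Ua kk kk' /qP /(_ h0); rewrite !rmorphM => /mulfI E.
  apply: (h0inj k k' kk kk'); apply: E.
  by rewrite -unitfE rmorph_unit.
- by move=> x y l /qP E; apply/qP => h; rewrite !rmorphM E.
Qed.
End FixedPoints.

Lemma bounded_seq_cover (A : eqType) (P : A -> Prop) (c : nat) :
  (forall l, uniq l -> (forall x, x \in l -> P x) -> (size l <= c)%N) ->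
  exists l : seq A, forall x, P x -> x \in l.
Proof.
move=> bnd; pose good n := `[< exists l : seq A,
  [/\ uniq l, forall x, x \in l -> P x & size l = n] >].
have ex0 : exists n, good n by exists 0%N; apply/asboolP; exists [::].
have le_c n : good n -> (n <= c)%N by move=> /asboolP[l [U lP <-]]; apply: bnd.
case: (ex_maxnP ex0 le_c) => n /asboolP[l [U lP sl]] maxl.
exists l => x Px; apply/negPn/negP => xl.
suff : ((size l).+1 <= n)%N by rewrite sl ltnn.
apply: maxl; apply/asboolP; exists (x :: l); split=> //=; first by rewrite xl.
by move=> y; rewrite inE => /predU1P[->|/lP].
Qed.

Definition infinitely_many_fixed (R : eqType) (rho : R -> R) : Prop :=
  forall m, exists ks : seq R,
    [/\ uniq ks, forall k, k \in ks -> rho k = k & size ks = m].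

Lemma pchar0_infinitely_many_fixed (R : idomainType) (rho : {rmorphism R -> R}) :
  [pchar R] =i pred0 -> infinitely_many_fixed rho.
Proof.
move=> /pcharf0P ch0 m; exists [seq n%:R | n <- iota 0 m].
split; last by rewrite size_map size_iota.
- rewrite map_inj_uniq ?iota_uniq // => x y.
  wlog lexy : x y / (x <= y)%N.
    by move=> W E; case/orP: (leq_total x y) => ?; [|symmetry]; apply: W.
  move=> /eqP; rewrite eq_sym -subr_eq0 -natrB // ch0 subn_eq0 => leyx.
  by apply/eqP; rewrite eqn_leq lexy.
- by move=> _ /mapP[n _ ->]; rewrite rmorph_nat.
Qed.

(** * Finite covers of the affine group *)

Section AffineCover.
Variables (R : idomainType) (gs : seq R).
Hypothesis genR : forall r : R, ring_gen gs r.
Variable rho : {rmorphism R -> R}.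

(* The two equations say that [(w, r)] is twisted conjugate to the class of [h]
   in [R x| U(R)] under [(v, y) |-> (rho v, a * rho y + _)]; taking [w = a^-1]
   turns the second one into a statement about the cokernel of [1 - rho]. *)
Lemma no_finite_affine_cover (T : eqType) (s : seq T) (u : T -> R)
    (C : R -> R -> T -> R) (a : R) :
  infinitely_many_fixed rho -> a \is a GRing.unit ->
  (forall w r, w \is a GRing.unit -> exists v y h,
     [/\ v \is a GRing.unit, h \in s, w * rho v = v * u h
       & r = y - w * a * rho y + C w v h]) -> False.
Proof.
move=> inf Ua cov.
(* The unit equation alone shows that the [u h] cover the cokernel of [v |-> v / rho v]. *)
have bndE ks : uniq ks -> (forall k, k \in ks -> k \is a GRing.unit /\ rho k = k) ->
    (size ks <= size s)%N.
  rewrite -(size_map u s); apply: (fixed_le_coker_unit genR) => w Uw.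
  have [v [y [h [Uv hs E _]]]] := cov w 0 Uw.
  exists v, (u h); split; rewrite ?map_f // mulrAC -E mulrK // rmorph_unit //.
(* The quotient of two solutions [v] is a fixed unit, so there are at most [size s] solutions. *)
have bndV h : exists l : seq R, forall v,
    (v \is a GRing.unit /\ rho v = v * (a * u h)) -> v \in l.
  apply: (@bounded_seq_cover _ _ (size s)) => -[|v0 l] // Ul lP.
  have [U0 E0] := lP v0 (mem_head _ _).
  rewrite -(size_map (fun v => v / v0)); apply: bndE.
    by rewrite map_inj_uniq //; apply: mulIr; rewrite unitrV.
  move=> _ /mapP[v vl ->]; have [Uv Ev] := lP v vl; split.
    by rewrite unitrM Uv unitrV.
  have Uc : a * u h \is a GRing.unit.
    by rewrite -(unitrMr _ U0) -E0 rmorph_unit.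
  by rewrite rmorphM rmorphV //= Ev E0 invrM // mulrA mulrK.
have [Lf LfP] := choice bndV.
(* For [w = a^-1] the unit [v] lies in the finite list [Lf h], so finitely many constants
   [C a^-1 v h] occur. *)
pose ls := [seq C a^-1 v h | h <- s, v <- Lf h].
have [ks [Uks fks sks]] := inf (size ls).+1.
suff : (size ks <= size ls)%N by rewrite sks ltnn.
apply: (fixed_le_coker_add genR (rho := rho)) => // r.
have [|v [y [h [Uv hs E ->]]]] := cov a^-1 r; first by rewrite unitrV.
exists y, (C a^-1 v h); split; last by rewrite mulVr // mul1r.
apply: allpairs_f_dep => //; apply: LfP; split => //.
by rewrite mulrCA -E mulrA mulrV // mul1r.
Qed.
End AffineCover.

(** * Localizations of F_q[t] *)

(** One root per polynomial is enough: coprimality to an irreducible [g] is tested below at a single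
    root of [g]. *)
Lemma common_root_extension (F : finFieldType) (f : seq {poly F}) :
  (forall g, g \in f -> (1 < size g)%N) ->
  exists (L : finFieldType) (j : {rmorphism F -> L}),
    forall g, g \in f -> exists z, root (map_poly j g) z.
Proof.
elim: f => [|g f IHf] sf; first by exists F, idfun.
have [|L [j jP]] := IHf; first by move=> h hf; apply: sf; rewrite inE hf orbT.
have [|L' [j' [z rz]]] := @finField_ext_root L (map_poly j g).
  by rewrite size_map_poly sf ?mem_head.
exists L', (j' \o j : {rmorphism F -> L'}) => h.
rewrite inE => /predU1P[->|/jP[y ry]]; first by exists z; rewrite map_poly_comp.
by exists (j' y); rewrite map_poly_comp; apply: rmorph_root.
Qed.

(** * A binary form without nontrivial zeros over a finite field *)

Section FermatForm.

(* The homogenization of [X^M - X + 1]; over a field of order M its only zero is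
   the origin. *)
Definition fermat_form (A : nzRingType) (M : nat) (a b : A) : A :=
  a ^+ M - a * b ^+ M.-1 + b ^+ M.

(** If [y != 0] then [y ^+ M.-1 = 1] and the value is [y]; otherwise it is [x]. *)
Lemma fermat_form_neq0 (L : fieldType) (M : nat) (x y : L) :
  (1 < M)%N -> x ^+ M = x -> y ^+ M = y -> (x != 0) || (y != 0) ->
  fermat_form M x y != 0.
Proof.
move=> M1 xM yM; rewrite /fermat_form xM yM.
have [->|y0 _] := eqVneq y 0.
  by rewrite orbF expr0n (_ : M.-1 == 0%N = false) ?mulr0 ?subr0 ?addr0 //; lia.
have -> : y ^+ M.-1 = 1.
  by apply: (mulfI y0); rewrite -exprS prednK ?mulr1 // (ltnW M1).
by rewrite mulr1 subrr add0r.
Qed.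

Lemma rmorph_fermat_form (A B : nzRingType) (h : {rmorphism A -> B}) M a b :
  h (fermat_form M a b) = fermat_form M (h a) (h b).
Proof. by rewrite /fermat_form rmorphD rmorphB rmorphM !rmorphXn. Qed.

Lemma fermat_form_dehomogenize (A : comNzRingType) M (x y : A) : (0 < M)%N ->
  fermat_form M x 1 * y ^+ M = fermat_form M (x * y) y.
Proof.
case: M => // M _; rewrite /fermat_form !expr1n exprMn !(exprS y) /=.
by move: (x ^+ M.+1) (y ^+ M) => u v; ring.
Qed.

Lemma coef_mul_top (A : comNzRingType) (p q : {poly A}) (m n : nat) :
  (size p <= m.+1)%N -> (size q <= n.+1)%N -> (p * q)`_(m + n) = p`_m * q`_n.
Proof.
move=> sp sq; rewrite coefM.
have mn : (m < (m + n).+1)%N by lia.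
rewrite (bigD1 (Ordinal mn)) //= addKn big1 ?addr0 // => i im.
have {im} : (i < m)%N || (m < i)%N.
  by move: im; rewrite -val_eqE /= neq_ltn.
case/orP => im; last by rewrite nth_default ?mul0r //; apply: leq_trans sp _.
by rewrite [q`_ _]nth_default ?mulr0 //; apply: leq_trans sq _; lia.
Qed.

Lemma coef_exp_top (A : comNzRingType) (p : {poly A}) (m k : nat) :
  (size p <= m.+1)%N -> (size (p ^+ k) <= (k * m).+1)%N /\ (p ^+ k)`_(k * m) = p`_m ^+ k.
Proof.
move=> sp; elim: k => [|k [IHs IHc]].
  by rewrite !expr0 mul0n size_poly1 coef1.
rewrite !exprS mulSn coef_mul_top ?IHc //; split=> //.
by apply: leq_trans (size_polyMleq _ _) _; lia.
Qed.

Lemma coef_fermat_form (A : comNzRingType) (M m : nat) (a b : {poly A}) :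
  (0 < M)%N -> (size a <= m.+1)%N -> (size b <= m.+1)%N ->
  (fermat_form M a b)`_(M * m) = fermat_form M a`_m b`_m.
Proof.
move=> M0 sa sb; have [_ ea] := coef_exp_top M sa.
have [_ eb] := coef_exp_top M sb; have [sb' eb'] := coef_exp_top M.-1 sb.
rewrite /fermat_form coefD coefB ea eb; congr (_ - _ + _).
by rewrite -[in LHS](prednK M0) mulSn coef_mul_top // eb'.
Qed.
End FermatForm.

(** * Automorphisms of the localization *)

Section Localization.
Variables (R : idomainType) (F : finFieldType) (f : seq {poly F}).
Variable iota : {rmorphism {poly F} -> R}.
Hypothesis f_irr : forall g, g \in f -> irreducible_poly g.
Hypothesis iota_inj : injective iota.
Hypothesis f_unit : forall g, g \in f -> iota g \is a GRing.unit.
Local Notation pf := (\prod_(g <- f) g).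
Hypothesis R_loc : forall r : R, exists (p : {poly F}) (k : nat),
  r * iota (pf ^+ k) = iota p.

Variables (L : finFieldType) (j : {rmorphism F -> L}).
Hypothesis j_root : forall g, g \in f -> exists z, root (map_poly j g) z.
Variable M : nat.
Hypothesis M_gt1 : (1 < M)%N.
Hypothesis expLM : forall x : L, x ^+ M = x.

(** At a root [z] in [L] of a common irreducible factor the form would vanish at [(a(z), b(z))], so
    both values would be zero, against coprimality. *)
Lemma fermat_form_coprime (a b : {poly F}) (k : nat) :
  coprimep a b -> coprimep (fermat_form M a b) (pf ^+ k).
Proof.
move=> cab; apply: coprimep_expr; rewrite big_seq.
apply: (big_ind (fun q => coprimep (fermat_form M a b) q)) => //.
- exact: coprimep1.
- by move=> p q cp cq; rewrite coprimepMr cp.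
move=> g gf; rewrite coprimep_sym (irreducible_poly_coprime _ (f_irr gf)).
have [z rz] := j_root gf; apply/negP => /dvdpP[q Eq].
have : fermat_form M (map_poly j a).[z] (map_poly j b).[z] == 0.
  rewrite -!/(horner_eval z _) -!rmorph_fermat_form Eq rmorphM /=.
  by rewrite /horner_eval hornerM (rootP rz) mulr0.
apply/negP/fermat_form_neq0; rewrite ?expLM //.
rewrite -negb_and; apply/negP => /andP[az bz].
have := cab; rewrite -(coprimep_map j) => /coprimep_root/(_ az).
by rewrite bz.
Qed.

Lemma unit_pf k : iota (pf ^+ k) \is a GRing.unit.
Proof.
rewrite rmorphXn unitrX // rmorph_prod big_seq.
by apply: rpred_prod => g; apply: f_unit.
Qed.

Lemma reduced_fraction (x : R) : exists (a b : {poly F}) (k : nat),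
  [/\ coprimep a b, b %| pf ^+ k, iota b \is a GRing.unit & x * iota b = iota a].
Proof.
have [p [k E]] := R_loc x; set q := pf ^+ k in E.
have q0 : q != 0.
  by apply: contraTneq (unit_pf k) => /= q0; rewrite -/q q0 rmorph0 unitr0.
pose d := gcdp p q; have d0 : d != 0 by rewrite gcdp_eq0 negb_and q0 orbT.
have qE : q = q %/ d * d by rewrite divpK ?dvdp_gcdr.
have pE : p = p %/ d * d by rewrite divpK ?dvdp_gcdl.
have Uq := unit_pf k; rewrite -/q qE rmorphM unitrM in Uq.
have /andP[Ub Ud] := Uq.
exists (p %/ d), (q %/ d), k; split => //.
- by rewrite coprimep_div_gcd ?q0 ?orbT.
- by rewrite [X in _ %| X](_ : _ = q) // [X in _ %| X]qE dvdp_mulr.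
- by apply: (mulIr Ud); rewrite -mulrA -!rmorphM /= -qE -pE.
Qed.

(** This is ['X^M - 'X + 1]. It is coprime to all denominators, hence a nonunit in [R], and its
    image under an endomorphism of [R] depends only on that of [iota 'X]. *)
Let G : {poly F} := fermat_form M 'X 1.

Lemma fermat_form_size (a b : {poly F}) (m : nat) :
  (size a <= m.+1)%N -> (size b <= m.+1)%N -> (a`_m != 0) || (b`_m != 0) ->
  (M * m < size (fermat_form M a b))%N.
Proof.
move=> sa sb ab; rewrite ltnNge; apply/negP => /(nth_default 0)/eqP.
rewrite coef_fermat_form ?(ltnW M_gt1) //; apply/negP.
have FM (x : F) : x ^+ M = x.
  by apply: (fmorph_inj j); rewrite rmorphXn expLM.
exact: fermat_form_neq0.
Qed.

Lemma size_G : size G = M.+1.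
Proof.
apply/eqP; rewrite eqn_leq; apply/andP; split.
  rewrite /G /fermat_form !expr1n mulr1.
  rewrite (leq_trans (size_polyD _ _)) // geq_max size_poly1 andbT.
  rewrite (leq_trans (size_polyD _ _)) // geq_max size_polyN size_polyXn leqnn.
  by rewrite size_polyX ltnS ltnW.
rewrite -[X in (X < _)%N]muln1; apply: fermat_form_size.
- by rewrite size_polyX.
- by rewrite size_poly1.
- by rewrite coefX oner_eq0.
Qed.

Lemma G_coprime k : coprimep G (pf ^+ k).
Proof. exact/fermat_form_coprime/coprimep1. Qed.

Lemma iota_G : iota G = fermat_form M (iota 'X) 1.
Proof. by rewrite rmorph_fermat_form rmorph1. Qed.

(** Denominators are invertible modulo [G] by Bezout; Euclidean division then gives the
    remainder. *)
Lemma residue_G (r : R) : exists (Q : {poly F}) (c : R),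
  (size Q <= M)%N /\ r = iota Q + iota G * c.
Proof.
have [p [k E]] := R_loc r.
have /Bezout_eq1_coprimepP[[U V] /= UV] := G_coprime k.
exists ((V * p) %% G), (r * iota U + iota ((V * p) %/ G)); split.
  by rewrite -ltnS -size_G ltn_modp -size_poly_eq0 size_G.
rewrite -[LHS]mulr1 -(rmorph1 iota) -UV.
rewrite (_ : r * _ = iota G * (r * iota U) + iota (V * p)); last first.
  by rewrite rmorphM -E rmorphD !rmorphM; ring.
have -> : iota (V * p) = iota ((V * p) %/ G) * iota G + iota ((V * p) %% G).
  by rewrite -rmorphM -rmorphD -divp_eq.
by ring.
Qed.

(* [theta] identifies the quotients of R by [iota G] and by its image; their
   orders are [#|F| ^ M] and [#|F| ^ (M * m)], where m is the degree of the
   fraction [theta (iota 'X)]. *)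
Lemma aut_degree_le1 (theta : {rmorphism R -> R}) (theta' : R -> R) :
  cancel theta' theta ->
  exists a b : {poly F}, [/\ (size a <= 2)%N, (size b <= 2)%N,
    iota b \is a GRing.unit & theta (iota 'X) * iota b = iota a].
Proof.
move=> thK; have [a [b [k [cab bk Ub E]]]] := reduced_fraction (theta (iota 'X)).
exists a, b; pose m := (maxn (size a) (size b)).-1.
have b0 : b != 0 by apply: contraTneq Ub => ->; rewrite rmorph0 unitr0.
have sb0 : (0 < size b)%N by rewrite size_poly_gt0.
have sa : (size a <= m.+1)%N by rewrite /m; lia.
have sb : (size b <= m.+1)%N by rewrite /m; lia.
have top : (a`_m != 0) || (b`_m != 0).
  rewrite /m; have [le|lt] := leqP (size a) (size b).
    by rewrite -lead_coefE lead_coef_eq0 b0 orbT.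
  by rewrite -lead_coefE lead_coef_eq0 -size_poly_gt0 (leq_ltn_trans _ lt).
have sN := fermat_form_size sa sb top.
have EG : theta (iota G) * iota b ^+ M = iota (fermat_form M a b).
  rewrite iota_G rmorph_fermat_form rmorph1 rmorph_fermat_form -E.
  exact/fermat_form_dehomogenize/ltnW.
have ex (v : 'rV[F]_(M * m)) : exists w : 'rV[F]_M, exists c : R,
    theta' (iota (rVpoly v)) = iota (rVpoly w) + iota G * c.
  have [Q [c [sQ ->]]] := residue_G (theta' (iota (rVpoly v))).
  by exists (poly_rV Q), c; rewrite poly_rV_K.
have [red redP] := choice ex.
(* Polynomials with equal residues differ by a multiple of [theta (iota G)], hence of the form at
   [(a, b)], whose degree is at least [M * m]. *)
have red_inj : injective red.
  move=> v v' Ev; have [c Ec] := redP v; have [c' Ec'] := redP v'.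
  have Ed : iota (rVpoly v - rVpoly v') = theta (iota G) * theta (c - c').
    rewrite rmorphB -(thK (iota (rVpoly v))) -(thK (iota (rVpoly v'))) Ec Ec' Ev.
    rewrite -rmorphB -rmorphM.
    by congr (theta _); rewrite mulrBr opprD addrACA subrr add0r.
  have [p [l El]] := R_loc (theta (c - c')).
  have dv : fermat_form M a b %| (rVpoly v - rVpoly v') * (b ^+ M * pf ^+ l).
    apply/dvdpP; exists p; apply: iota_inj.
    rewrite (rmorphM iota p) -El -EG (rmorphM iota (_ - _)) Ed (rmorphM iota (b ^+ M)).
    by rewrite (rmorphXn iota M b) mulrACA [RHS]mulrC.
  have : fermat_form M a b %| rVpoly v - rVpoly v'.
    rewrite -(Gauss_dvdpl _ (_ : coprimep _ (b ^+ M * pf ^+ l))) // coprimepMr.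
    rewrite fermat_form_coprime // andbT coprimep_expr //.
    by rewrite coprimep_sym (coprimep_dvdr bk) // coprimep_sym fermat_form_coprime.
  move=> dvN; apply: (can_inj rVpolyK); apply/eqP; rewrite -subr_eq0.
  apply/negPn/negP => n0; have := leq_trans sN (dvdp_leq n0 dvN).
  rewrite ltnNge (leq_trans (size_polyD _ _)) // geq_max size_polyN.
  by rewrite !size_poly.
have := leq_card _ red_inj; rewrite !card_mx !mul1n leq_exp2l ?finNzRing_gt1 //.
rewrite -[X in (_ <= X)%N]muln1 leq_pmul2l ?(ltnW M_gt1) // => m1.
by split => //; [apply: leq_trans sa _ | apply: leq_trans sb _].
Qed.

(** All iterates send the variable to one of finitely many fractions of degree at most one, so the
    variable is periodic. The product of [iota G] over its orbit is a fixed nonzero nonunit, whose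
    powers are distinct. *)
Lemma localization_infinitely_many_fixed (rho : {rmorphism R -> R}) :
  bijective rho -> infinitely_many_fixed rho.
Proof.
move=> bij_rho; have rho_inj := bij_inj bij_rho; have [rho' _ rhoK] := bij_rho.
have iterP i : exists (theta : {rmorphism R -> R}) (theta' : R -> R),
    theta =1 iter i rho /\ cancel theta' theta.
  elim: i => [|i [th [th' [thE thK]]]].
    by exists idfun, id.
  exists (rho \o th : {rmorphism R -> R}), (th' \o rho'); split => [x|x] /=.
    by rewrite thE.
  by rewrite thK rhoK.
have iter_inj i : injective (iter i rho).
  by elim: i => //= i IHi x y /rho_inj; apply: IHi.
have [N N0 perN] : exists2 N, (0 < N)%N & iter N rho (iota 'X) = iota 'X.
  pose bnd := #|{: 'rV[F]_2 * 'rV[F]_2}|.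
  have ex (i : 'I_bnd.+1) : exists w : 'rV[F]_2 * 'rV[F]_2,
      iota (rVpoly w.2) \is a GRing.unit /\
      iter i rho (iota 'X) * iota (rVpoly w.2) = iota (rVpoly w.1).
    have [th [th' [thE thK]]] := iterP i.
    have [a [b [sa sb Ub E]]] := aut_degree_le1 thK.
    by exists (poly_rV a, poly_rV b); rewrite /= !poly_rV_K // -thE.
  have [w wP] := choice ex.
  have /injectivePn[i [i' ii' Ew]] : ~~ injectiveb w.
    by apply/negP => /injectiveP/leq_card; rewrite card_ord ltnn.
  wlog lt : i i' ii' Ew / (i < i')%N.
    move=> W; move: (ii'); rewrite neq_ltn => /orP[/W|/W]; first exact.
    by apply => //; rewrite eq_sym.
  exists (i' - i)%N; first by rewrite subn_gt0.
  apply: (iter_inj i); rewrite -iterD subnKC; last exact: ltnW.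
  have [Ui Ei] := wP i; have [_ Ei'] := wP i'.
  by rewrite -Ew in Ei'; apply: (mulIr Ui); rewrite Ei.
have perG : iter N rho (iota G) = iota G.
  have [th [_ [thE _]]] := iterP N.
  by rewrite -thE iota_G rmorph_fermat_form thE perN rmorph1.
pose n := \prod_(i < N) iter i rho (iota G).
have rho_n : rho n = n.
  rewrite /n -(prednK N0) rmorph_prod big_ord_recr big_ord_recl /= mulrC.
  congr (_ * _); first by rewrite -iterS prednK.
have G0 : iota G != 0.
  rewrite -(rmorph0 iota) (inj_eq iota_inj) -size_poly_eq0 size_G //.
have n0 : n != 0.
  apply/prodf_neq0 => i _; rewrite -[0](_ : iter i rho 0 = 0) ?(inj_eq (@iter_inj i)) //.
  by have [th [_ [thE _]]] := iterP i; rewrite -thE rmorph0.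
(* If [iota G] were a unit, [G] would divide a power of [pf], to which it is coprime. *)
have nU : n \isn't a GRing.unit.
  apply/negP; rewrite /n -(prednK N0) big_ord_recl /= unitrM => /andP[UG _].
  have [p [k E]] := R_loc (iota G)^-1.
  have : G %| pf ^+ k.
    apply/dvdpP; exists p; apply: iota_inj; rewrite rmorphM -E.
    by rewrite mulrAC mulVr // mul1r.
  rewrite -[pf ^+ k]mul1r Gauss_dvdpl ?G_coprime // dvdp1 size_G.
  by rewrite eqSS -leqn0 leqNgt (ltnW M_gt1).
move=> m; exists [seq n ^+ i | i <- seq.iota 0 m].
split; last by rewrite size_map size_iota.
  rewrite map_inj_uniq ?iota_uniq // => x y.
  wlog le : x y / (x <= y)%N.
    by move=> W E; case/orP: (leq_total x y) => ?; [|symmetry]; apply: W.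
  rewrite -[in n ^+ y](subnKC le) exprD -{1}[n ^+ x]mulr1 => /(mulfI (expf_neq0 _ n0)) E.
  apply/eqP; rewrite eqn_leq le /= -subn_eq0 -leqn0 leqNgt; apply: contra nU => d0.
  by rewrite -(unitrX_pos _ d0) -E unitr1.
by move=> _ /mapP[i _ ->]; rewrite rmorphXn rho_n.
Qed.
End Localization.

(** * Upper triangular groups *)

Section Upper.
Variables (R : idomainType) (n : nat).
Implicit Types A B : 'M[R]_n.+1.

(** [upper 0] means upper triangular and [upper 1] strictly so; the index adds up under products. *)
Definition upper (k : nat) A := forall i j : 'I_n.+1, (j < i + k)%N -> A i j = 0.

Lemma upperM k l A B : upper k A -> upper l B -> upper (k + l) (A * B).
Proof.
move=> uA uB i j ij; rewrite mxE big1 // => h _.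
have [hi|hi] := ltnP h (i + k); first by rewrite uA ?mul0r.
by rewrite (uB h j) ?mulr0 //; lia.
Qed.

Lemma upperB k A B : upper k A -> upper k B -> upper k (A - B).
Proof. by move=> uA uB i j ij; rewrite !mxE uA ?uB ?subr0. Qed.

Lemma upper_eq0 k A : (n < k)%N -> upper k A -> A = 0.
Proof. by move=> nk uA; apply/matrixP => i j; rewrite mxE uA //; have := ltn_ord j; lia. Qed.

Lemma mul_upper_diag A B i : upper 0 A -> upper 0 B -> (A * B) i i = A i i * B i i.
Proof.
move=> uA uB; rewrite mxE (bigD1 i) //= big1 ?addr0 // => h.
rewrite -val_eqE neq_ltn /= => /orP[hi|hi].
  by rewrite (uA i h) ?mul0r ?addn0.
by rewrite (uB h i) ?mulr0 ?addn0.
Qed.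

Lemma mul_upper_superdiag A B (i j : 'I_n.+1) : nat_of_ord j = i.+1 ->
  upper 0 A -> upper 0 B -> (A * B) i j = A i i * B i j + A i j * B j j.
Proof.
move=> ji uA uB; have ij : i != j by rewrite -val_eqE /=; lia.
rewrite mxE (bigD1 i) //= (bigD1 j) 1?eq_sym //= big1 ?addr0 // => h.
rewrite -!val_eqE /= => hij; have [hi|hi] := ltnP h i.
  by rewrite (uA i h) ?mul0r ?addn0.
by rewrite (uB h j) ?mulr0 ?addn0 // ji; lia.
Qed.

Lemma upper_unitmx A : upper 0 A -> (forall i, A i i \is a GRing.unit) ->
  A \is a GRing.unit.
Proof.
move=> uA dA; change (is_true (A \in unitmx)); rewrite unitmxE -det_tr det_trig.
  by apply: rpred_prod => i _; rewrite mxE.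
by apply/is_trig_mxP => i j ij; rewrite mxE uA ?addn0.
Qed.

Lemma upperV A : upper 0 A -> (forall i, A i i \is a GRing.unit) -> upper 0 A^-1.
Proof.
move=> uA dA i j; rewrite addn0; have UA := upper_unitmx uA dA.
have [k] := ubnP (n.+1 - i); elim: k => // k IHk in i *; rewrite ltnS => ik ji.
have := congr1 (fun B : 'M_n.+1 => B i j) (mulrV UA); rewrite mxE (bigD1 i) //= big1.
  rewrite addr0 mxE -val_eqE gtn_eqF //= => /eqP.
  by rewrite mulf_eq0 => /orP[/eqP A0|/eqP//]; have := dA i; rewrite A0 unitr0.
move=> h; rewrite -val_eqE neq_ltn /= => /orP[hi|hi].
  by rewrite (uA i h) ?mul0r ?addn0.
by rewrite IHk ?mulr0 //; have := ltn_ord h; lia.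
Qed.

Lemma mul_deltaE A (i j k l : 'I_n.+1) :
  (A * delta_mx i j) k l = A k i * (l == j)%:R.
Proof.
rewrite mxE (bigD1 i) //= big1 => [|h hi]; rewrite !mxE ?eqxx ?addr0 //.
by rewrite (negbTE hi) mulr0.
Qed.

Lemma delta_mulE A (i j k l : 'I_n.+1) :
  (delta_mx i j * A) k l = (k == i)%:R * A j l.
Proof.
rewrite mxE (bigD1 j) //= big1 => [|h hj]; rewrite !mxE ?eqxx ?addr0 ?andbT //.
by rewrite (negbTE hj) andbF mul0r.
Qed.

End Upper.

(** * The group S, its affine quotients and its Engel elements *)

Section Solvable.
Variables (R : idomainType) (n : nat) (I : {set 'I_n.+1}).
Implicit Types (g h x y : 'M[R]_n.+1) (i j : 'I_n.+1).
Local Notation G := (@inSI R n.+1 I).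
Local Notation upper := (@upper R n).

Lemma SI_upper g : G g -> upper 0 g.
Proof. by case=> H _ _ i j; rewrite addn0; apply: H. Qed.

Lemma SI_diag_unit g i : G g -> g i i \is a GRing.unit.
Proof. by case. Qed.

Lemma SI_diag_neq0 g i : G g -> g i i != 0.
Proof. by move=> /SI_diag_unit => /(_ i); apply: contraTneq => ->; rewrite unitr0. Qed.

Lemma SI_unit g : G g -> g \is a GRing.unit.
Proof. by move=> Gg; apply: upper_unitmx; [apply: SI_upper | case: Gg]. Qed.

Lemma SI1 : G 1.
Proof.
split=> [i j ji|i|i _]; rewrite mxE ?eqxx ?unitr1 //.
by rewrite -val_eqE gtn_eqF.
Qed.

Lemma SIM g h : G g -> G h -> G (g * h).
Proof.
move=> Gg Gh; have ug := SI_upper Gg; have uh := SI_upper Gh; split=> [i j ji|i|i iI].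
- by apply: (upperM ug uh); rewrite !addn0.
- by rewrite mul_upper_diag // unitrM !SI_diag_unit.
- by rewrite mul_upper_diag //; case: Gg Gh => _ _ -> // [_ _ ->]; rewrite ?mulr1.
Qed.

Lemma SIV_upper g : G g -> upper 0 g^-1.
Proof. by move=> Gg; apply: upperV; [apply: SI_upper | case: Gg]. Qed.

Lemma SIV_diag g i : G g -> g i i * g^-1 i i = 1.
Proof.
move=> Gg; rewrite -mul_upper_diag; [|exact: SI_upper|exact: SIV_upper].
by rewrite divrr ?SI_unit // mxE eqxx.
Qed.

Lemma SIV g : G g -> G g^-1.
Proof.
move=> Gg; split=> [i j ji|i|i iI].
- by apply: SIV_upper; rewrite ?addn0.
- by apply/unitrPr; exists (g i i); rewrite mulrC SIV_diag.
- by have := SIV_diag i Gg; case: Gg => _ _ -> //; rewrite mul1r.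
Qed.

Definition comm g h := g * h * g^-1 * h^-1.

Lemma SI_comm g h : G g -> G h -> G (comm g h).
Proof. by move=> Gg Gh; rewrite /comm; do !apply: SIM => //; apply: SIV. Qed.

Lemma commK g h : G g -> G h -> comm g h * (h * g) = g * h.
Proof. by move=> Gg Gh; rewrite /comm mulrA !mulrVK ?SI_unit. Qed.

Lemma comm_diag g h i : G g -> G h -> comm g h i i = 1.
Proof.
move=> Gg Gh; have Gc := SI_comm Gg Gh.
have := congr1 (fun A : 'M_n.+1 => A i i) (commK Gg Gh).
have [ug uh uc] := And3 (SI_upper Gg) (SI_upper Gh) (SI_upper Gc).
rewrite (mul_upper_diag _ uc (upperM uh ug)) (mul_upper_diag _ uh ug) (mul_upper_diag _ ug uh).
rewrite [h i i * _]mulrC -[RHS]mul1r => /mulIf; apply.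
by rewrite mulf_neq0 ?SI_diag_neq0.
Qed.

(** For adjacent [i], [j] the 2 x 2 diagonal block modulo scalars is the affine map [x |-> W x + P],
    so [(W, P)] is a homomorphism to R x| U(R). *)
Definition W i j g := g i i / g j j.
Definition P i j g := g i j / g j j.

Section Adjacent.
Variables i j : 'I_n.+1.
Hypothesis adj : nat_of_ord j = i.+1.
Local Notation W := (W i j).
Local Notation P := (P i j).

Lemma W_unit g : G g -> W g \is a GRing.unit.
Proof. by move=> Gg; rewrite unitrM unitrV !SI_diag_unit. Qed.

Lemma WM g h : G g -> G h -> W (g * h) = W g * W h.
Proof.
move=> Gg Gh; rewrite /W !mul_upper_diag; try exact: SI_upper.
by rewrite invrM ?SI_diag_unit //; ring.
Qed.

Lemma PM g h : G g -> G h -> P (g * h) = W g * P h + P g.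
Proof.
move=> Gg Gh; rewrite /P /W mul_upper_superdiag ?mul_upper_diag //; try exact: SI_upper.
rewrite invrM ?SI_diag_unit // mulrDl; congr (_ + _); first by ring.
by rewrite mulrA mulrK ?SI_diag_unit.
Qed.

Lemma W_comm g h : G g -> G h -> W (comm g h) = 1.
Proof. by move=> Gg Gh; rewrite /W !comm_diag ?divr1. Qed.

Lemma P_comm g h : G g -> G h ->
  P (comm g h) = (W g - 1) * P h - (W h - 1) * P g.
Proof.
move=> Gg Gh; have := congr1 P (commK Gg Gh).
rewrite (PM (SI_comm Gg Gh) (SIM Gh Gg)) (W_comm Gg Gh) mul1r (PM Gg Gh) (PM Gh Gg) => E.
by apply: (addrI (W h * P g + P h)); rewrite E; ring.
Qed.

Lemma P1 : P 1 = 0.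
Proof. by rewrite /P mxE -val_eqE /= adj ltn_eqF // mul0r. Qed.
End Adjacent.

Definition emx i j (r : R) : 'M[R]_n.+1 := 1 + r *: delta_mx i j.

Lemma emxE i j r k l : emx i j r k l = (k == l)%:R + r * ((k == i) && (l == j))%:R.
Proof. by rewrite !mxE. Qed.

Lemma emx_diag i j r k : (i < j)%N -> emx i j r k k = 1.
Proof.
move=> ij; rewrite emxE eqxx; case: (eqVneq k i) => [->|] /=; last by rewrite mulr0 addr0.
by rewrite -val_eqE /= ltn_eqF // mulr0 addr0.
Qed.

Lemma emx_ij i j r : (i < j)%N -> emx i j r i j = r.
Proof. by move=> ij; rewrite emxE !eqxx -val_eqE /= ltn_eqF // mulr1 add0r. Qed.

Lemma emx0 i j : emx i j 0 = 1.
Proof. by rewrite /emx scale0r addr0. Qed.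

Lemma SI_emx i j r : (i < j)%N -> G (emx i j r).
Proof.
move=> ij; split=> [k l lk|k|k _]; rewrite ?emx_diag ?unitr1 //.
rewrite emxE -val_eqE gtn_eqF // add0r; case: eqP => [ki|]; rewrite ?mulr0 //=.
by case: eqP => [lj|]; rewrite ?mulr0 //; move: lk; rewrite ki lj ltnNge ltnW.
Qed.

Lemma emxD i j r s : (i < j)%N -> emx i j (r + s) = emx i j r * emx i j s.
Proof.
move=> ij; rewrite /emx mulrDl mul1r mulrDr mulr1 -scalerAl -scalerAr.
rewrite (_ : delta_mx i j * delta_mx i j = 0); last first.
  apply/matrixP => k l; rewrite mul_deltaE !mxE andbC -val_eqE /= ltn_eqF //.
  by rewrite mul0r.
by rewrite !scaler0 addr0 -addrA [s *: _ + _]addrC scalerDl.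
Qed.

(** Scalars are allowed on the diagonal because they are central, so commutators cannot detect
    them. *)
Definition nilrad g := G g /\ forall i j, g i i = g j j.
Local Notation N := nilrad.

Lemma nilradM g h : N g -> N h -> N (g * h).
Proof.
move=> [Gg dg] [Gh dh]; split=> [|i j]; first exact: SIM.
by rewrite !mul_upper_diag ?(dg i j) ?(dh i j) //; apply: SI_upper.
Qed.

Lemma nilradV g : N g -> N g^-1.
Proof.
move=> [Gg dg]; split=> [|i j]; first exact: SIV.
by apply: (mulfI (SI_diag_neq0 i Gg)); rewrite SIV_diag // (dg i j) SIV_diag.
Qed.

Lemma nilrad_comm g h : G g -> G h -> N (comm g h).
Proof. by move=> Gg Gh; split=> [|i j]; [apply: SI_comm | rewrite !comm_diag]. Qed.

Lemma nilrad_emx i j r : (i < j)%N -> N (emx i j r).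
Proof. by move=> ij; split=> [|k l]; [apply: SI_emx | rewrite !emx_diag]. Qed.

Lemma nilrad_W g i j : N g -> W i j g = 1.
Proof. by move=> [Gg dg]; rewrite /W (dg i j) divrr ?SI_diag_unit. Qed.

(* This group-theoretic description makes [nilrad] automorphism invariant. *)
Lemma nilrad_engel g : G g ->
  (N g <-> forall h, G h -> iter n.+2 (comm^~ g) h = 1).
Proof.
move=> Gg; split=> [[_ dg] h Gh|E].
  have step k : G (iter k (comm^~ g) h) /\
      (0 < k -> upper k (iter k (comm^~ g) h - 1))%N.
    elim: k => [|k [Gk IHk]] //=; set y := iter k _ h in Gk IHk *.
    have Gc := SI_comm Gk Gg; split=> // _.
    have [->|k0] := posnP k.
      move=> i l; rewrite addn1 ltnS => li; rewrite mxE.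
      move: li; rewrite leq_eqVlt => /orP[/eqP/val_inj->|li].
        by rewrite comm_diag // !mxE eqxx subrr.
      by rewrite (SI_upper Gc) ?addn0 // !mxE -val_eqE gtn_eqF // subrr.
    have Gyg : G (g * y) by apply: SIM.
    pose c : 'M[R]_n.+1 := (g ord0 ord0)%:M.
    have cC A : c * A = A * c by apply: esym; apply: scalar_mxC.
    (* Subtracting 1 from [y] and the scalar [c] from [g] does not change [y * g - g * y], and
       [g - c] is strictly upper, so one superdiagonal is gained. *)
    have -> : comm y g - 1 = ((y - 1) * (g - c) - (g - c) * (y - 1)) * (g * y)^-1.
      apply: (mulIr (SI_unit Gyg)); rewrite mulrVK ?SI_unit // mulrBl mul1r commK //.
      rewrite !mulrBl !mulrBr !mul1r !mulr1 cC.
      move: (y * g) (y * c) (g * y) => a b d; apply/matrixP => i l; rewrite !mxE.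
      by ring.
    rewrite -[k.+1]addn0; apply: upperM; last by apply: SIV_upper.
    have ug : upper 1 (g - c).
      move=> i l; rewrite addn1 ltnS => li; rewrite !mxE.
      move: li; rewrite leq_eqVlt => /orP[/eqP/val_inj->|li].
        by rewrite eqxx mulr1n (dg i ord0) subrr.
      have -> : (i == l) = false by rewrite -val_eqE gtn_eqF.
      by rewrite mulr0n subr0 (SI_upper Gg) ?addn0.
    apply: upperB; first by rewrite -addn1; apply: upperM => //; apply: IHk.
    by rewrite -add1n; apply: upperM => //; apply: IHk.
  have [_ /(_ isT)/upper_eq0] := step n.+2.
  by move=> /(_ (leqnSn _))/eqP; rewrite subr_eq0 => /eqP.
split=> //.
(* If the two entries differ, each commutation of [emx i j 1] with [g] multiplies [P] by the nonzero
   [1 - W i j g], so 1 is never reached. *)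
have adjE i j : nat_of_ord j = i.+1 -> g i i = g j j.
  move=> ji; apply/eqP/negPn/negP => gij.
  have ij : (i < j)%N by rewrite ji.
  have W1 : 1 - W i j g != 0.
    rewrite subr_eq0 eq_sym; apply: contra gij => /eqP Wg.
    by rewrite -[g j j]mul1r -Wg /W mulrVK ?SI_diag_unit.
  have step k : [/\ G (iter k (comm^~ g) (emx i j 1)),
      W i j (iter k (comm^~ g) (emx i j 1)) = 1
    & P i j (iter k (comm^~ g) (emx i j 1)) != 0].
    elim: k => [|k [Gk Wk Pk]] /=.
      split; [exact: SI_emx|exact/nilrad_W/nilrad_emx|].
      by rewrite /P emx_ij // emx_diag // divr1 oner_eq0.
    split; [exact: SI_comm|exact: W_comm|].
    by rewrite P_comm // Wk subrr mul0r sub0r -mulNr opprB mulf_neq0.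
  have [_ _] := step n.+2; rewrite E ?P1 ?eqxx //; exact: SI_emx.
have E0 k (i : 'I_n.+1) : nat_of_ord i = k -> g i i = g ord0 ord0.
  elim: k i => [|k IHk] i ik; first by congr (g _ _); apply: val_inj.
  have kn : (k < n.+1)%N by rewrite -ltnS -ik ltnW // ltnS ltn_ord.
  by rewrite -(IHk (Ordinal kn)) // -(adjE (Ordinal kn) i).
by move=> i j; rewrite (E0 _ i erefl) (E0 _ j erefl).
Qed.
End Solvable.

(** * The second center of N and the corner coordinates *)

Section Corners.
Variables (R : idomainType) (m : nat) (I : {set 'I_m.+4}).
Implicit Types (g h x y z : 'M[R]_m.+4) (i j k l : 'I_m.+4) (b : bool).
Local Notation G := (@inSI R m.+4 I).
Local Notation N := (@nilrad R m.+3 I).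
Local Notation emx := (@emx R m.+3).

(** Counting from 1, these are the indices 1, 2, n-1 and n, distinct since n >= 4. *)
Definition i0 : 'I_m.+4 := ord0.
Definition i1 : 'I_m.+4 := @Ordinal m.+4 1 isT.
Definition ia : 'I_m.+4 := Ordinal (ltnW (ltnSn m.+3)).
Definition iz : 'I_m.+4 := ord_max.

Lemma upper_mul_delta0 x l : upper 0 x ->
  x * delta_mx i0 l = x i0 i0 *: delta_mx i0 l.
Proof.
move=> ux; apply/matrixP => k h; rewrite mul_deltaE !mxE.
case: (eqVneq k i0) => [->//|ki]; rewrite ux ?mul0r ?mulr0 // addn0.
by rewrite lt0n.
Qed.

Lemma delta_last_mul_upper x k : upper 0 x ->
  delta_mx k iz * x = x iz iz *: delta_mx k iz.
Proof.
move=> ux; apply/matrixP => h l; rewrite delta_mulE !mxE.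
case: (eqVneq l iz) => [->|lz]; first by rewrite andbT mulrC.
rewrite andbF ux ?mulr0 // addn0 ltn_neqAle; rewrite -val_eqE in lz.
by rewrite lz -ltnS ltn_ord.
Qed.

Lemma delta_mul_upper x : upper 0 x -> delta_mx i0 ia * x =
  x ia ia *: delta_mx i0 ia + x ia iz *: delta_mx i0 iz.
Proof.
move=> ux; apply/matrixP => k l; rewrite delta_mulE !mxE.
case: (eqVneq k i0) => _ /=; last by rewrite mul0r !mulr0 addr0.
rewrite mul1r; case: (eqVneq l ia) => [->|la].
  by rewrite -val_eqE /= ltn_eqF // mulr1 mulr0 addr0.
case: (eqVneq l iz) => [->|lz]; first by rewrite mulr0 mulr1 add0r.
rewrite ux ?mulr0 ?addr0 // addn0; rewrite -!val_eqE /= in la lz *.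
by have := ltn_ord l; lia.
Qed.

Lemma upper_mul_delta x : upper 0 x -> x * delta_mx i1 iz =
  x i1 i1 *: delta_mx i1 iz + x i0 i1 *: delta_mx i0 iz.
Proof.
move=> ux; apply/matrixP => k l; rewrite mul_deltaE !mxE.
case: (eqVneq l iz) => _ /=; last by rewrite !andbF !mulr0 addr0.
rewrite !andbT mulr1; case: (eqVneq k i1) => [->|k1].
  by rewrite -val_eqE /= mulr1 mulr0 addr0.
case: (eqVneq k i0) => [->|k0]; first by rewrite mulr0 mulr1 add0r.
rewrite ux ?mulr0 ?addr0 // addn0; rewrite -!val_eqE /= in k0 k1 *.
by lia.
Qed.

Definition in_corner k l :=
  [|| (k == i0) && (l == ia), (k == i1) && (l == iz) | (k == i0) && (l == iz)].

Definition corner_mx z :=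
  N z /\ forall k l, (k < l)%N -> ~~ in_corner k l -> z k l = 0.

Lemma corner_mx_decomp z : corner_mx z ->
  z = (z i0 i0)%:M + z i0 ia *: delta_mx i0 ia + z i1 iz *: delta_mx i1 iz
    + z i0 iz *: delta_mx i0 iz.
Proof.
move=> [[Gz dz] sz]; apply/matrixP => k l; rewrite !mxE.
have [lk|kl|/val_inj->] := ltngtP l k.
- rewrite (SI_upper Gz) ?addn0 //.
  rewrite (_ : k == l = false) ?mulr0n; last by rewrite -val_eqE gtn_eqF.
  have H (a c : 'I_m.+4) : (a < c)%N -> (k == a) && (l == c) = false.
    move=> ac; apply/negP => /andP[/eqP ka /eqP lc].
    by move: lk; rewrite ka lc ltnNge ltnW.
  by rewrite !H // !mulr0 !addr0.
- rewrite (_ : k == l = false) ?mulr0n; last by rewrite -val_eqE ltn_eqF.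
  rewrite add0r; case: (boolP (in_corner k l)) => [|nc].
    by case/or3P => /andP[/eqP-> /eqP->]; rewrite -!val_eqE /= !eqxx
      ?(ltn_eqF (ltnSn _)) ?(gtn_eqF (ltnSn _)) ?mulr0 ?mulr1 ?addr0 ?add0r.
  rewrite sz //; move: nc; rewrite /in_corner !negb_or.
  by case/and3P=> /negbTE-> /negbTE-> /negbTE->; rewrite !mulr0 !addr0.
- rewrite eqxx mulr1n (dz k i0).
  have H (a c : 'I_m.+4) : (a < c)%N -> (k == a) && (k == c) = false.
    move=> ac; apply/negP => /andP[/eqP ka /eqP kc].
    by move: ac; rewrite -ka -kc ltnn.
  by rewrite !H // !mulr0 !addr0.
Qed.

Lemma corner_bracket z x : corner_mx z -> N x ->
  z * x - x * z = (z i0 ia * x ia iz - z i1 iz * x i0 i1) *: delta_mx i0 iz.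
Proof.
move=> cz [Gx dx]; have ux := SI_upper Gx.
move: (corner_mx_decomp cz); move: (z i0 i0) (z i0 ia) (z i1 iz) (z i0 iz).
move=> s a b c ->; rewrite !mulrDl !mulrDr -!scalerAl -!scalerAr.
rewrite !upper_mul_delta0 // !delta_last_mul_upper // delta_mul_upper // upper_mul_delta //.
rewrite (dx iz i0) (dx ia i0) (dx i1 i0).
have -> : s%:M * x = x * s%:M by apply: esym; apply: scalar_mxC.
move: (x * _) (delta_mx i0 ia) (delta_mx i1 iz) (delta_mx i0 iz) => A B C D.
move: (x i0 i0) (x ia iz) (x i0 i1) => d e f.
apply/matrixP => k l; rewrite !mxE; ring.
Qed.

(** The two ends of the superdiagonal: [false] stands for position (1,2), [true] for (n-1,n). *)
Definition ci b := if b then ia else i0.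
Definition cj b := if b then iz else i1.
Definition cW b x := W (ci b) (cj b) x.
Definition cP b x := P (ci b) (cj b) x.
(* The coordinates on the second center dual to [cP] under commutation. *)
Definition cdual b z := if b then z i0 ia / z i0 i0 else - (z i1 iz / z i0 i0).

Lemma c_adj b : nat_of_ord (cj b) = (ci b).+1. Proof. by case: b. Qed.

(** Pairing of the second center with the corner coordinates, valued in the center; it expresses the
    multiplication of [R] by commutators. *)
Lemma corner_comm z x : corner_mx z -> N x ->
  comm z x = emx i0 iz (cdual true z * cP true x + cdual false z * cP false x).
Proof.
move=> cz Nx; have [Nz _] := cz; have [[Gz dz] [Gx dx]] := (Nz, Nx).
apply: (mulIr (SI_unit (SIM Gx Gz))); rewrite (commK Gz Gx) /emx mulrDl mul1r.
rewrite -scalerAl delta_last_mul_upper ?scalerA; last exact: (SI_upper (SIM Gx Gz)).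
rewrite (mul_upper_diag _ (SI_upper Gx) (SI_upper Gz)).
apply/eqP; rewrite -subr_eq0 opprD addrA subr_eq0; apply/eqP.
rewrite corner_bracket //; congr (_ *: _).
rewrite /cP /P /= (dx iz i0) (dx i1 i0) (dz iz i0).
have Ux := SI_diag_unit i0 Gx; have Uz := SI_diag_unit i0 Gz.
have K (a c : R) : a / z i0 i0 * (c / x i0 i0) * (x i0 i0 * z i0 i0) = a * c.
  by rewrite [a / _ * _]mulrACA -(invrM Ux Uz) mulrVK // unitrM Ux.
by rewrite mulrDl !mulNr !K.
Qed.

(** Only commutation within N enters these notions, so automorphisms preserve them; their matrix
    shapes are found below. *)
Definition nilrad_center z := N z /\ forall y, N y -> z * y = y * z.
Definition nilrad_center2 z := N z /\ forall y, N y -> nilrad_center (comm z y).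
Definition cent_center2 x := N x /\ forall z, nilrad_center2 z -> x * z = z * x.

Lemma center_emx r : nilrad_center (emx i0 iz r).
Proof.
split=> [|y [Gy dy]]; first exact: nilrad_emx.
rewrite /emx mulrDl mulrDr mul1r mulr1 -scalerAl -scalerAr.
rewrite upper_mul_delta0 ?delta_last_mul_upper ?(dy iz i0) //; exact: SI_upper Gy.
Qed.

Lemma comm_emx_eq (A B : 'M[R]_m.+4) i j : A * emx i j 1 = emx i j 1 * B ->
  A = B -> forall k l, A k i * (l == j)%:R = (k == i)%:R * A j l.
Proof.
move=> E AB k l; rewrite -AB /emx mulrDl mulrDr mul1r mulr1 !scale1r in E.
by move/addrI/matrixP/(_ k l): E; rewrite mul_deltaE delta_mulE.
Qed.

Lemma center_entries z : nilrad_center z ->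
  forall k l, (k < l)%N -> ~~ ((k == i0) && (l == iz)) -> z k l = 0.
Proof.
move=> [[Gz dz] cz] k l kl nc.
have C i j : (i < j)%N -> forall k l, z k i * (l == j)%:R = (k == i)%:R * z j l.
  by move=> ij; apply: comm_emx_eq => //; apply/cz/nilrad_emx.
have [lz|lz] := eqVneq l iz.
  rewrite lz eqxx andbT in nc; have k0 : (i0 < k)%N by rewrite lt0n.
  have := C _ _ k0 i0 l; rewrite eqxx mul1r => <-.
  by rewrite -(val_eqE l k) gtn_eqF // mulr0.
have lz' : (l < iz)%N.
  by rewrite ltn_neqAle -ltnS ltn_ord andbT; rewrite -val_eqE in lz.
have := C _ _ lz' k iz; rewrite eqxx mulr1 => ->.
by rewrite -val_eqE ltn_eqF // mul0r.
Qed.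

Lemma center_emx_eq z : nilrad_center z -> (forall k, z k k = 1) ->
  z = emx i0 iz (z i0 iz).
Proof.
move=> Zz dz; have [[Gz _] _] := Zz.
apply/matrixP => k l; rewrite emxE; have [lk|kl|/val_inj lk] := ltngtP l k.
- rewrite (SI_upper Gz) ?addn0 // -val_eqE gtn_eqF // add0r.
  case: eqP => [k0|]; rewrite ?mulr0 //.
  by move: lk; rewrite k0.
- rewrite -val_eqE ltn_eqF // add0r.
  case: (boolP ((k == i0) && (l == iz))) => [/andP[/eqP-> /eqP->]|nkl].
    by rewrite mulr1.
  by rewrite mulr0 (center_entries Zz).
- rewrite lk eqxx dz (_ : _ && _ = false) ?mulr0 ?addr0 //.
  by apply/negP => /andP[/eqP->].
Qed.

(** An element of the second center commutes with every elementary matrix up to the (1,n) entry, and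
    suitable elementary matrices force the remaining entries to vanish. *)
Lemma center2_corner z : nilrad_center2 z <-> corner_mx z.
Proof.
split=> [[Nz c2z]|cz]; last first.
  split=> [|y Ny]; first by case: cz.
  by rewrite corner_comm //; apply: center_emx.
have [Gz dz] := Nz; split=> // k l kl nc.
have C i j : (i < j)%N -> forall k l, ~~ ((k == i0) && (l == iz)) ->
    z k i * (l == j)%:R = (k == i)%:R * z j l.
  move=> ij k' l' ncz; have Ny := @nilrad_emx R m.+3 I i j 1 ij; have [Gy _] := Ny.
  have Zc := c2z _ Ny; set c := comm _ _ in Zc.
  have cE : c = emx i0 iz (c i0 iz).
    by apply: center_emx_eq Zc _ => a; apply: comm_diag Gz Gy.
  have := commK Gz Gy; rewrite -/c cE /emx mulrDl mul1r -scalerAl.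
  rewrite delta_last_mul_upper; last exact: (SI_upper (SIM Gy Gz)).
  rewrite scalerA !mulrDl !mulrDr !mul1r !mulr1 !scale1r -addrA => /addrI E.
  move/matrixP/(_ k' l'): E => E; rewrite mul_deltaE in E.
  by rewrite -E mxE delta_mulE ![in X in _ + X]mxE (negbTE ncz) mulr0 addr0.
rewrite /in_corner !negb_or in nc; have /and3P[n0a n1z n0z] := nc.
have [lz|lz] := eqVneq l iz.
  rewrite lz eqxx !andbT in n1z n0z *.
  have k1 : (i1 < k)%N.
    by rewrite -!val_eqE /= in n1z n0z; rewrite /=; lia.
  have := C _ _ k1 i1 iz; rewrite eqxx mul1r => <- //.
  by rewrite -(val_eqE iz k) gtn_eqF ?mulr0 // -lz.
have lz' : (l < iz)%N.
  by rewrite ltn_neqAle -ltnS ltn_ord andbT; rewrite -val_eqE in lz.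
have [k0|k0] := eqVneq k i0; last first.
  have := C _ _ lz' k iz; rewrite eqxx mulr1 (negbTE k0) => -> //.
  by rewrite -val_eqE ltn_eqF // mul0r.
rewrite k0 eqxx /= in n0a *.
have la : (l < ia)%N.
  by rewrite -val_eqE /= in n0a lz'; rewrite /= in lz' *; lia.
have := C _ _ la i0 ia; rewrite !eqxx mulr1 => -> //.
  by rewrite -val_eqE ltn_eqF ?mul0r // -k0.
by rewrite -val_eqE /= ltn_eqF.
Qed.

Definition ce b s := emx (ci b) (cj b) s.
(** The minus sign cancels the one in [cdual], so [cmk b] and [ce b] are dual under the commutator
    pairing. *)
Definition cmk b r := if b then emx i0 ia r else emx i1 iz (- r).

Lemma c_lt b : (ci b < cj b)%N. Proof. by rewrite c_adj. Qed.

Lemma nilrad_ce b s : N (ce b s).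
Proof. exact/nilrad_emx/c_lt. Qed.

Lemma ce_D b s t : ce b (s + t) = ce b s * ce b t.
Proof. exact: emxD (c_lt b). Qed.

Lemma cP_ce b b' s : cP b' (ce b s) = if b' == b then s else 0.
Proof.
rewrite /cP /P emx_diag ?c_lt // divr1; case: (eqVneq b' b) => [->|nb].
  by rewrite emx_ij ?c_lt.
rewrite /ce emxE -!val_eqE /= c_adj ltn_eqF // add0r.
by case: b b' nb => [] [] //= _; rewrite ?andbF ?mulr0.
Qed.

Lemma corner_cmk b r : corner_mx (cmk b r).
Proof.
case: b; rewrite /cmk; (split; first exact: nilrad_emx) => k l kl;
  rewrite /in_corner !negb_or => /and3P[/negbTE na /negbTE n1 _];
  rewrite emxE -val_eqE ltn_eqF // add0r.
  by rewrite na mulr0.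
by rewrite n1 mulr0.
Qed.

Lemma cdual_cmk b b' r : cdual b' (cmk b r) = if b' == b then r else 0.
Proof.
have h1 : (i0 < ia)%N by []; have h2 : (i1 < iz)%N by [].
by case: b b' => [] [] /=; rewrite emx_diag // divr1 ?emx_ij ?opprK // emxE
  -!val_eqE /= ?mulr0 ?addr0 ?oppr0.
Qed.

(** The pairing is nondegenerate on the corner coordinates: [cmk b 1] detects [cP b]. *)
Lemma cent_center2P x : cent_center2 x <-> N x /\ forall b, cP b x = 0.
Proof.
split=> [[Nx cx]|[Nx Px]]; split=> //; last first.
  move=> z /center2_corner cz; apply/esym/eqP; rewrite -subr_eq0 (corner_bracket cz Nx).
  have [Gx _] := Nx.
  have E b : x (ci b) (cj b) = 0.
    apply/eqP; have := Px b; rewrite /cP /P => /eqP.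
    by rewrite mulf_eq0 invr_eq0 (negbTE (SI_diag_neq0 _ Gx)) orbF.
  by rewrite (E true) (E false) !mulr0 subr0 scale0r.
move=> b; have [Gx _] := Nx.
have /cx E : nilrad_center2 (cmk b 1) by apply/center2_corner/corner_cmk.
have : comm (cmk b 1) x = 1.
  have [[Gc _] _] := corner_cmk b 1.
  apply: (mulIr (SI_unit (SIM Gx Gc))).
  by rewrite (commK Gc Gx) mul1r.
rewrite (corner_comm (corner_cmk b 1) Nx) => /matrixP/(_ i0 iz).
rewrite emx_ij // mxE !cdual_cmk /=.
by case: b {E} => /=; rewrite mul1r mul0r ?addr0 ?add0r.
Qed.

(** An element of S with affine component [(v, r)] at corner [b], trivial at the other. The ratio
    [v] is placed at [ci b] if [I] allows it; otherwise (NG) puts [cj b] in [I] and [v^-1] goes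
    there. *)
Definition celt b (v r : R) : 'M[R]_m.+4 :=
  let c0 := if ci b \in I then v else 1 in
  let c1 := if ci b \in I then 1 else v^-1 in
  \matrix_(k, l) if k == l then if k == ci b then c0 else if k == cj b then c1 else 1
    else if (k == ci b) && (l == cj b) then r * c1 else 0.

Lemma celtP b v r : NG_condition I -> v \is a GRing.unit ->
  [/\ G (celt b v r), cW b (celt b v r) = v, cP b (celt b v r) = r,
      cW (~~ b) (celt b v r) = 1 & cP (~~ b) (celt b v r) = 0].
Proof.
move=> ng Uv.
set c0 := if ci b \in I then v else 1; set c1 := if ci b \in I then 1 else v^-1.
have U0 : c0 \is a GRing.unit by rewrite /c0; case: ifP; rewrite ?unitr1.
have U1 : c1 \is a GRing.unit by rewrite /c1; case: ifP; rewrite ?unitr1 ?unitrV.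
have ji : cj b == ci b = false by rewrite -val_eqE /= c_adj gtn_eqF.
have ij : ci b == cj b = false by rewrite eq_sym.
have ni : ci (~~ b) == ci b = false by case: b {c0 c1 U0 U1 ji ij}.
have nj : ci (~~ b) == cj b = false by case: b {c0 c1 U0 U1 ji ij ni}.
have ni' : cj (~~ b) == ci b = false by case: b {c0 c1 U0 U1 ji ij ni nj}.
have nj' : cj (~~ b) == cj b = false by case: b {c0 c1 U0 U1 ji ij ni nj ni'}.
have nij : ci (~~ b) == cj (~~ b) = false by rewrite -val_eqE /= c_adj ltn_eqF.
split.
- split=> [k l lk|k|k kI]; rewrite !mxE.
  + rewrite -val_eqE gtn_eqF //; case: ifP => // /andP[/eqP ki /eqP lj].
    by move: lk; rewrite ki lj ltnNge ltnW ?c_lt.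
  + by rewrite eqxx; case: ifP => // _; case: ifP => // _; rewrite unitr1.
  + rewrite eqxx; case: ifP => [/eqP ki|_].
      by rewrite /c0 -ki (negbTE kI).
    case: ifP => [/eqP kj|//]; rewrite /c1; case: ifP => // /negbT iI.
    by move: kI; rewrite kj (ng _ _ (c_adj b) iI).
- rewrite /cW /W !mxE !eqxx ji -/c0 -/c1 /c0 /c1.
  by case: ifP => _; rewrite ?divr1 ?invrK ?mul1r.
- by rewrite /cP /P !mxE !eqxx ij ji /= -/c1 mulrK.
- by rewrite /cW /W !mxE !eqxx ni nj ni' nj' divr1.
- by rewrite /cP /P !mxE !eqxx nij ni /= mul0r.
Qed.
End Corners.

(** * Automorphisms *)

Section Automorphism.
Variables (R : idomainType) (m : nat) (I : {set 'I_m.+4}).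
Implicit Types (g h x y z : 'M[R]_m.+4) (b : bool) (s t : R).
Local Notation G := (@inSI R m.+4 I).
Local Notation N := (@nilrad R m.+3 I).
Local Notation CZ := (@cent_center2 R m I).
Local Notation ce := (@ce R m).
Local Notation cmk := (@cmk R m).
Local Notation emx := (@emx R m.+3).
Local Notation i0 := (i0 m).
Local Notation iz := (iz m).
Local Notation cP := (@cP R m).
Local Notation cW := (@cW R m).

Variable phi : 'M[R]_m.+4 -> 'M[R]_m.+4.
Hypothesis aut_phi : SI_aut I phi.

Lemma aut_SI g : G g -> G (phi g).
Proof. by case: aut_phi => H _ _ _; apply: H. Qed.

Lemma aut_inj g h : G g -> G h -> phi g = phi h -> g = h.
Proof. by case: aut_phi => _ H _ _; apply: H. Qed.

Lemma aut_surj h : G h -> exists2 g, G g & phi g = h.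
Proof. by case: aut_phi => _ _ H _; apply: H. Qed.

Lemma autM g h : G g -> G h -> phi (g * h) = phi g * phi h.
Proof. by case: aut_phi => _ _ _ H; apply: H. Qed.

Lemma aut1 : phi 1 = 1.
Proof.
have G1 := @SI1 R m.+3 I; apply: (mulIr (SI_unit (aut_SI G1))).
by rewrite -autM // !mul1r.
Qed.

Lemma autV g : G g -> phi g^-1 = (phi g)^-1.
Proof.
move=> Gg; apply: (mulIr (SI_unit (aut_SI Gg))).
by rewrite -autM ?mulVr ?aut1 ?(SI_unit (aut_SI Gg)) ?(SI_unit Gg) //; apply: SIV.
Qed.

Lemma aut_comm g h : G g -> G h -> phi (comm g h) = comm (phi g) (phi h).
Proof.
move=> Gg Gh; rewrite /comm !autM ?autV //; do ?[apply: SIM | apply: SIV] => //.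
Qed.

Lemma nilrad_aut g : G g -> (N g <-> N (phi g)).
Proof.
move=> Gg.
have Giter k h : G h -> G (iter k (fun y => comm y g) h).
  by move=> Gh; elim: k => //= k IHk; apply: SI_comm.
have iterE k h : G h ->
    phi (iter k (fun y => comm y g) h) = iter k (fun y => comm y (phi g)) (phi h).
  by move=> Gh; elim: k => //= k <-; rewrite aut_comm //; apply: Giter.
rewrite (nilrad_engel Gg) (nilrad_engel (aut_SI Gg)); split=> E h Gh.
  by have [h' Gh' <-] := aut_surj Gh; rewrite -iterE // E // aut1.
apply: aut_inj; [exact: Giter|exact: SI1|].
by rewrite iterE // E ?aut1 //; apply: aut_SI.
Qed.

Lemma center_aut z : G z -> (nilrad_center I z <-> nilrad_center I (phi z)).
Proof.
move=> Gz; split=> -[Nz cz]; split; try exact/(nilrad_aut Gz).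
- move=> y Ny; have [Gy _] := Ny; have [y' Gy' E] := aut_surj Gy.
  by rewrite -E in Ny *; rewrite -!autM // cz //; apply/(nilrad_aut Gy').
- move=> y Ny; have [Gy _] := Ny; apply: aut_inj; try exact: SIM.
  by rewrite !autM // cz //; apply/(nilrad_aut Gy).
Qed.

Lemma center2_aut z : G z -> (nilrad_center2 I z <-> nilrad_center2 I (phi z)).
Proof.
move=> Gz; split=> -[Nz cz]; split; try exact/(nilrad_aut Gz).
- move=> y Ny; have [Gy _] := Ny; have [y' Gy' E] := aut_surj Gy.
  rewrite -E in Ny *; rewrite -aut_comm //; apply/(center_aut (SI_comm Gz Gy')).
  by apply: cz; apply/(nilrad_aut Gy').
- move=> y Ny; have [Gy _] := Ny; apply/(center_aut (SI_comm Gz Gy)).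
  by rewrite aut_comm //; apply: cz; apply/(nilrad_aut Gy).
Qed.

Lemma cent_center2_aut x : G x -> (CZ x <-> CZ (phi x)).
Proof.
move=> Gx; split=> -[Nx cx]; split; try exact/(nilrad_aut Gx).
- move=> z c2z; have [[Gz _] _] := c2z; have [z' Gz' E] := aut_surj Gz.
  by rewrite -E in c2z *; rewrite -!autM // cx //; apply/(center2_aut Gz').
- move=> z c2z; have [[Gz _] _] := c2z; apply: aut_inj; try exact: SIM.
  by rewrite !autM // cx //; apply/(center2_aut Gz).
Qed.

Lemma cPM_nilrad b x y : N x -> N y -> cP b (x * y) = cP b x + cP b y.
Proof.
move=> Nx Ny; have [[Gx _] [Gy _]] := (Nx, Ny).
by rewrite /cP (PM (c_adj m b) Gx Gy) (nilrad_W _ _ Nx) mul1r addrC.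
Qed.

Lemma cP_comm b g h : G g -> G h ->
  cP b (comm g h) = (cW b g - 1) * cP b h - (cW b h - 1) * cP b g.
Proof. exact: (P_comm (c_adj m b)). Qed.

(** [x] differs from the product of the two [ce] elements by an element of [CZ], which [phi]
    preserves. *)
Lemma cP_aut_decomp b b' x : N x ->
  cP b' (phi x) = cP b' (phi (ce b (cP b x))) + cP b' (phi (ce (~~ b) (cP (~~ b) x))).
Proof.
move=> Nx; set e := ce b _; set e' := ce (~~ b) _.
have Ne : N e by apply: nilrad_ce.
have Ne' : N e' by apply: nilrad_ce.
have [[Gx _] [[Ge _] [Ge' _]]] := (Nx, (Ne, Ne')).
have Nee := nilradM Ne Ne'; have [Gee _] := Nee.
pose c := (e * e')^-1 * x; have Nc : N c by apply: nilradM => //; apply: nilradV.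
have xE : x = (e * e') * c by rewrite mulVKr // (SI_unit Gee).
have Gc : G c by case: Nc.
have Zc : CZ c.
  apply/cent_center2P; split=> // d; have := congr1 (cP d) xE.
  rewrite (cPM_nilrad _ Nee Nc) (cPM_nilrad _ Ne Ne') /e /e' !cP_ce.
  have [nb nb'] : (b == ~~ b) = false /\ (~~ b == b) = false by case: (b).
  have [->|->] : d = b \/ d = ~~ b by case: (d) (b) => -[]; [left|right|right|left].
    by rewrite eqxx nb addr0 -{1}[cP _ x]addr0 => /addrI.
  by rewrite eqxx nb' add0r -{1}[cP _ x]addr0 => /addrI.
have /(cent_center2_aut Gc)/cent_center2P[Nfc /(_ b') fc0] := Zc.
have N1 := proj1 (nilrad_aut Ge) Ne; have N2 := proj1 (nilrad_aut Ge') Ne'.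
have -> : phi x = phi e * phi e' * phi c by rewrite [in LHS]xE (autM Gee Gc) (autM Ge Ge').
by rewrite (cPM_nilrad _ (nilradM N1 N2) Nfc) fc0 addr0 (cPM_nilrad _ N1 N2).
Qed.

Lemma cP_aut_eq0 x : N x -> (forall b, cP b (phi x) = 0) <-> (forall b, cP b x = 0).
Proof.
move=> Nx; have [Gx _] := Nx; split=> P0.
  have /(cent_center2_aut Gx)/cent_center2P[] // : CZ (phi x).
  by apply/cent_center2P; split=> //; apply/(nilrad_aut Gx).
have /(cent_center2_aut Gx)/cent_center2P[] // : CZ x.
by apply/cent_center2P; split.
Qed.

Local Notation q b' b s := (cP b' (phi (ce b s))).

Lemma SI_ce b s : G (ce b s). Proof. by case: (nilrad_ce I b s). Qed.

Lemma q_D b' b s t : q b' b (s + t) = q b' b s + q b' b t.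
Proof.
rewrite ce_D (autM (SI_ce b s) (SI_ce b t)) cPM_nilrad //;
  apply/(nilrad_aut (SI_ce _ _)); exact: nilrad_ce.
Qed.

(** Each side says that a commutator lies in [CZ], that is, that the group element fixes a class in
    the quotient R^2 of N. *)
Lemma stabilizer_aut g x : G g -> N x ->
  (forall b, (cW b g - 1) * cP b x = 0) <->
  (forall b, (cW b (phi g) - 1) * cP b (phi x) = 0).
Proof.
move=> Gg Nx; have [Gx _] := Nx.
have Nfx := proj1 (nilrad_aut Gx) Nx; have [Gfx _] := Nfx; have Gfg := aut_SI Gg.
have := cP_aut_eq0 (nilrad_comm Gg Gx); rewrite aut_comm // => E.
have E1 b : cP b (comm g x) = (cW b g - 1) * cP b x.
  by rewrite (cP_comm b Gg Gx) (nilrad_W _ _ Nx : cW b x = 1) subrr mul0r subr0.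
have E2 b : cP b (comm (phi g) (phi x)) = (cW b (phi g) - 1) * cP b (phi x).
  by rewrite (cP_comm b Gfg Gfx) (nilrad_W _ _ Nfx : cW b (phi x) = 1) subrr mul0r subr0.
split=> H b; first by rewrite -E2; move: b; apply/E => b; rewrite E1.
by rewrite -E1; move: b; apply/E => b; rewrite E2.
Qed.

Hypothesis ng : NG_condition I.
Variable u : R.
Hypotheses (Uu : u \is a GRing.unit) (u1 : u != 1).

(** If both components were nonzero, [phi] would carry the kernel of [cW b] onto the common kernel
    of both characters. The element [c], in the kernel of [cW b] but not of the other character,
    refutes this. *)
Lemma cP_aut_pure1 b s : q b b s = 0 \/ q (~~ b) b s = 0.
Proof.
case: (eqVneq (q b b s) 0) => [->|p1]; first by left.
case: (eqVneq (q (~~ b) b s) 0) => [->|p2]; first by right.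
exfalso.
have Ne := nilrad_ce I b s.
have mix g : G g -> cW b g = 1 <-> forall d, cW d (phi g) = 1.
  move=> Gg; have st := stabilizer_aut Gg Ne; split=> Wg.
    have H : forall d, (cW d g - 1) * cP d (ce b s) = 0.
      move=> d; rewrite cP_ce; case: eqP => [->|]; last by rewrite mulr0.
      by rewrite Wg subrr mul0r.
    have {}H d := proj1 st H d.
    move=> d; apply/eqP; rewrite -subr_eq0; apply/eqP.
    have [E|E] : d = b \/ d = ~~ b by case: (d) (b) => -[]; [left|right|right|left].
      by have /eqP := H d; rewrite {2}E mulf_eq0 (negbTE p1) orbF => /eqP.
    by have /eqP := H d; rewrite {2}E mulf_eq0 (negbTE p2) orbF => /eqP.
  have H d : (cW d (phi g) - 1) * cP d (phi (ce b s)) = 0 by rewrite Wg subrr mul0r.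
  have /eqP := proj2 st H b; rewrite cP_ce eqxx mulf_eq0 => /orP[|/eqP s0].
    by rewrite subr_eq0 => /eqP.
  by move: p1; rewrite (proj2 (cP_aut_eq0 Ne)) ?eqxx // => d; rewrite cP_ce s0 if_same.
have [Gc Wc _ Wc' _] := celtP (~~ b) 0 ng Uu; rewrite negbK in Wc'.
set c := celt _ _ _ _ in Gc Wc Wc'.
have [g0 Gg0 Eg0] := aut_surj Gc.
(* The preimage [x] of [ce b 1] turns triviality of [cW b] on [phi g] into a condition on [g]: [c]
   gives [cP (~~ b) x = 0], then the preimage [g0] of [c] gives [cW b g0 = 1], a contradiction. *)
have [x Gx Ex] := aut_surj (SI_ce b 1).
have Nx : N x by apply/(nilrad_aut Gx); rewrite Ex; apply: nilrad_ce.
have stx g : G g -> cW b (phi g) = 1 -> forall d, (cW d g - 1) * cP d x = 0.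
  move=> Gg Wg; apply/(stabilizer_aut Gg Nx) => d; rewrite Ex cP_ce.
  by case: eqP => [->|]; rewrite ?mulr0 // Wg subrr mul0r.
have Px' : cP (~~ b) x = 0.
  have /(_ (~~ b))/eqP := stx c Gc (proj1 (mix c Gc) Wc' b).
  by rewrite Wc mulf_eq0 subr_eq0 (negbTE u1) => /eqP.
have Px : cP b x != 0.
  apply/eqP => Px; have := proj2 (cP_aut_eq0 Nx) _ b.
  rewrite Ex cP_ce eqxx => H; have /eqP := oner_neq0 R; apply; apply: H => d.
  by have [->|->] : d = b \/ d = ~~ b by case: (d) (b) => -[]; [left|right|right|left].
have Wg0 : cW b g0 = 1.
  apply/eqP; rewrite -subr_eq0; apply/eqP.
  have Wfg0 : cW b (phi g0) = 1 by rewrite Eg0.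
  have /eqP := stx g0 Gg0 Wfg0 b.
  by rewrite mulf_eq0 (negbTE Px) orbF => /eqP.
have := proj1 (mix g0 Gg0) Wg0 (~~ b); rewrite Eg0 Wc => /eqP.
by rewrite (negbTE u1).
Qed.

(** A group is not the union of two proper subgroups. *)
Lemma cP_aut_pure b : (forall s, q b b s = 0) \/ (forall s, q (~~ b) b s = 0).
Proof.
case: (EM (forall s, q b b s = 0)) => [|/existsNP[s s0]]; [by left|right=> t].
have [t0|//] := cP_aut_pure1 b t.
have [s1|s1] := cP_aut_pure1 b s; first by case: s0.
have [st|st] := cP_aut_pure1 b (s + t).
  by case: s0; move: st; rewrite q_D t0 addr0.
by move: st; rewrite q_D s1 add0r.
Qed.

(* [sigma] tells whether [phi] exchanges the two corners, as the inverse of the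
   anti-transpose does. *)
Lemma cP_aut_perm : exists sigma : bool, forall b s, q (~~ (b (+) sigma)) b s = 0.
Proof.
have not0 b : ~ forall b' s, q b b' s = 0.
  move=> q0; have [x Gx Ex] := aut_surj (SI_ce b 1).
  have Nx : N x by apply/(nilrad_aut Gx); rewrite Ex; apply: nilrad_ce.
  have := cP_aut_decomp b b Nx; rewrite !q0 addr0 Ex cP_ce eqxx => /eqP.
  by rewrite oner_eq0.
have [f|f] := cP_aut_pure false; have [t|t] := cP_aut_pure true.
- by exists true => -[].
- by case: (not0 false) => -[].
- by case: (not0 true) => -[].
- by exists false => -[].
Qed.

(** * Ring automorphisms induced on the corners *)

Section Permuted.
Variables (sigma b : bool).
Hypothesis sigmaP : forall d s, q (~~ (d (+) sigma)) d s = 0.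
Local Notation b' := (b (+) sigma).
Local Notation alpha s := (q b' b s).

Lemma cP_aut_nilrad x : N x -> cP b' (phi x) = alpha (cP b x).
Proof.
move=> Nx; rewrite (cP_aut_decomp b b' Nx) -[RHS]addr0; congr (_ + _).
by have := sigmaP (~~ b) (cP (~~ b) x); rewrite addNb negbK.
Qed.

Lemma alpha_eq0 s : alpha s = 0 -> s = 0.
Proof.
move=> a0; have Ne := nilrad_ce I b s.
have H d : cP d (phi (ce b s)) = 0.
  have [->|->//] : d = b' \/ d = ~~ b' by case: (d) (b') => -[]; [left|right|right|left].
  exact: a0.
by have := proj1 (cP_aut_eq0 Ne) H b; rewrite cP_ce eqxx.
Qed.

Lemma alphaB s t : alpha (s - t) = alpha s - alpha t.
Proof. by apply: (addIr (alpha t)); rewrite -q_D !subrK. Qed.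

Lemma alpha_surj t : exists s, alpha s = t.
Proof.
have [x Gx Ex] := aut_surj (SI_ce b' t).
have Nx : N x by apply/(nilrad_aut Gx); rewrite Ex; apply: nilrad_ce.
by exists (cP b x); rewrite -cP_aut_nilrad // Ex cP_ce eqxx.
Qed.

Lemma alpha_cW g s : G g -> alpha (cW b g * s) = cW b' (phi g) * alpha s.
Proof.
move=> Gg; have Ne := nilrad_ce I b s; have Ge := SI_ce b s.
have := cP_aut_nilrad (nilrad_comm Gg Ge).
rewrite aut_comm // (cP_comm _ Gg Ge) (cP_comm _ (aut_SI Gg) (aut_SI Ge)).
have Nfe := proj1 (nilrad_aut Ge) Ne.
rewrite (nilrad_W _ _ Ne : cW b (ce b s) = 1).
rewrite (nilrad_W _ _ Nfe : cW b' (phi (ce b s)) = 1) subrr !mul0r !subr0.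
rewrite cP_ce eqxx !mulrBl !mul1r alphaB => E.
by apply: (addIr (- alpha s)).
Qed.

Let beta r := cdual b' (phi (cmk b r)).

Lemma aut_corner_mul r s : phi (emx i0 iz (r * s)) = emx i0 iz (beta r * alpha s).
Proof.
have cz := corner_cmk I b r; have Ne := nilrad_ce I b s; have Ge := SI_ce b s.
have [[Gz _] _] := cz.
have -> : emx i0 iz (r * s) = comm (cmk b r) (ce b s).
  rewrite (corner_comm cz Ne) !cP_ce !cdual_cmk; congr emx.
  by case: (b); rewrite /= ?mulr0 ?mul0r ?addr0 ?add0r.
rewrite aut_comm //; have cfz : corner_mx I (phi (cmk b r)).
  by apply/center2_corner/(center2_aut Gz)/center2_corner.
rewrite (corner_comm cfz (proj1 (nilrad_aut Ge) Ne)); congr emx.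
have := sigmaP b s; rewrite /beta; case: (b') => /= ->; rewrite mulr0 ?addr0 ?add0r //.
Qed.

Lemma beta_alpha r s r' s' : r * s = r' * s' -> beta r * alpha s = beta r' * alpha s'.
Proof.
move=> E; have := aut_corner_mul r s; rewrite E aut_corner_mul.
by move/matrixP/(_ i0 iz); rewrite !emx_ij.
Qed.

(** [beta r * alpha s] depends only on [r * s]. Comparison with arguments 1 eliminates [beta], as
    [beta 1] is nonzero by injectivity of [phi]. *)
Lemma alphaM r s : alpha r * alpha s = alpha 1 * alpha (r * s).
Proof.
have b0 : beta 1 != 0.
  apply/eqP => b0; have E := aut_corner_mul 1 1; rewrite b0 mul0r mulr1 in E.
  have {}E : phi (emx i0 iz 1) = phi 1 by rewrite E aut1 emx0.
  have /matrixP/(_ i0 iz) := aut_inj (SI_emx I 1 (isT : (i0 < iz)%N)) (@SI1 _ _ I) E.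
  by rewrite emx_ij // mxE => /eqP; rewrite oner_eq0.
have E1 t : beta t * alpha 1 = beta 1 * alpha t by apply: beta_alpha; rewrite mulr1 mul1r.
have E2 : beta r * alpha s = beta 1 * alpha (r * s) by apply: beta_alpha; rewrite mul1r.
apply: (mulfI b0); rewrite mulrA -E1 mulrAC E2; ring.
Qed.

(** If [alpha s = 1] then [alpha 1 * alpha (s * s) = 1]; dividing [alpha] by the unit [alpha 1]
    makes it multiplicative. *)
Lemma corner_ring_aut : exists tau : {rmorphism R -> R},
  [/\ bijective tau, alpha 1 \is a GRing.unit & forall s, alpha s = alpha 1 * tau s].
Proof.
have U1 : alpha 1 \is a GRing.unit.
  have [s as1] := alpha_surj 1; apply/unitrPr; exists (alpha (s * s)).
  by rewrite -alphaM as1 mulr1.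
pose f s := (alpha 1)^-1 * alpha s.
have fK s : alpha 1 * f s = alpha s by rewrite mulVKr.
have fB : {morph f : x y / x - y} by move=> x y; rewrite /f alphaB mulrBr.
have f1 : f 1 = 1 by rewrite /f mulVr.
have fM : {morph f : x y / x * y}.
  move=> x y; apply: (mulrI U1); apply: (mulrI U1).
  rewrite fK -alphaM; have := fK x; have := fK y; move: (f x) (f y) => fx fy <- <-.
  by ring.
pose tau : {rmorphism R -> R} := HB.pack_for {rmorphism R -> R} f
  (GRing.isZmodMorphism.Build _ _ f fB) (GRing.isMonoidMorphism.Build _ _ f (f1, fM)).
exists tau; split=> //.
have sj t : exists s, f s = t.
  by have [s E] := alpha_surj (alpha 1 * t); exists s; rewrite /f E mulKr.
have [g gK] := choice sj; exists g => // s.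
apply/eqP; rewrite -subr_eq0; apply/eqP/alpha_eq0; rewrite alphaB.
have : f (g (f s)) = f s by rewrite gK.
by move/(mulrI _) => ->; rewrite ?subrr ?unitrV.
Qed.

(** Commuting with [d], whose character value [u] is not 1, shows that the deviation of
    [cP b' (phi g)] from [a * tau (cP b g)] depends only on [cW b g]. It is read off at [e], which
    has the same character value and zero translation. *)
Lemma corner_structure : exists (tau : {rmorphism R -> R}) (a : R) (K : R -> R),
  [/\ bijective tau, a \is a GRing.unit,
      forall g, G g -> cW b' (phi g) = tau (cW b g)
    & forall g, G g -> cP b' (phi g) = a * tau (cP b g) + K (cW b g)].
Proof.
have [tau [bij Ua aE]] := corner_ring_aut; set a := alpha 1 in Ua aE.
have WE g : G g -> cW b' (phi g) = tau (cW b g).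
  move=> Gg; have := alpha_cW 1 Gg; rewrite mulr1 aE mulrC => /mulIf -> //.
  by apply: contraTneq Ua => ->; rewrite unitr0.
exists tau, a, (fun v => cP b' (phi (celt I b v 0))); split=> // g Gg.
have [Gd Wd Pd _ _] := celtP b 0 ng Uu; set d := celt _ _ _ _ in Gd Wd Pd.
have Uw : cW b g \is a GRing.unit by apply: W_unit Gg.
have [Ge We Pe _ _] := celtP b 0 ng Uw; set e := celt _ _ _ _ in Ge We Pe *.
have t1 : tau u - 1 != 0.
  by rewrite -(rmorph1 tau) subr_eq0 (inj_eq (bij_inj bij)).
have key h : G h -> (tau u - 1) * (cP b' (phi h) - a * tau (cP b h)) =
    (tau (cW b h) - 1) * cP b' (phi d).
  move=> Gh; have := cP_aut_nilrad (nilrad_comm Gd Gh).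
  rewrite aut_comm // (cP_comm _ (aut_SI Gd) (aut_SI Gh)) (cP_comm _ Gd Gh).
  rewrite Pd mulr0 subr0 aE rmorphM rmorphB rmorph1 !WE // Wd => /eqP.
  rewrite subr_eq => /eqP E; rewrite mulrBr E; ring.
have Ee := key e Ge; rewrite Pe rmorph0 mulr0 subr0 We in Ee.
by have := key g Gg; rewrite -Ee => /(mulfI t1) <-; rewrite addrC subrK.
Qed.
End Permuted.

(** The equation [g * phi x = x * h], for [g] trivial at the corner (n-1,n), is projected to the
    affine group of the corner (1,2). *)
Lemma aut_affine_cover (reps : seq 'M[R]_m.+4) :
  (forall x, x \in reps -> G x) ->
  (forall g, G g -> exists2 h, h \in reps & twisted_conj I phi g h) ->
  exists (rho : {rmorphism R -> R}) (a : R) (v0 : 'M[R]_m.+4 -> R)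
         (C : R -> R -> 'M[R]_m.+4 -> R),
  [/\ bijective rho, a \is a GRing.unit &
  forall w r, w \is a GRing.unit -> exists (v y : R) h,
     [/\ v \is a GRing.unit, h \in reps, w * rho v = v * v0 h
       & r = y - w * a * rho y + C w v h]].
Proof.
move=> repsG cov; have [sigma sP] := cP_aut_perm.
have [tau0 [a0 [K0 [bij0 U0 W0 P0]]]] := corner_structure false sP.
have [tau1 [a1 [K1 [bij1 U1 W1 P1]]]] := corner_structure true sP.
have covE g : G g -> exists x h, [/\ G x, h \in reps, G h & g * phi x = x * h].
  move=> Gg; have [h hr [x Gx E]] := cov g Gg; exists x, h; split=> //.
    exact: repsG.
  by rewrite E -[RHS]mulr1 -(mulVr (SI_unit (aut_SI Gx))) !mulrA.
have WM' d g h : G g -> G h -> cW d (g * h) = cW d g * cW d h by exact: WM.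
have PM' d g h : G g -> G h -> cP d (g * h) = cW d g * cP d h + cP d g.
  exact: (PM (c_adj m d)).
have WU d g : G g -> cW d g \is a GRing.unit by exact: W_unit.
case: sigma sP W0 P0 W1 P1 => sP /= W0 P0 W1 P1; last first.
  exists tau0, a0, (cW false), (fun w v h => v * cP false h - w * K0 v).
  split=> // w r Uw; have [Gg Wg Pg _ _] := celtP false r ng Uw.
  set g := celt _ _ _ _ in Gg Wg Pg.
  have [x [h [Gx hr Gh E]]] := covE g Gg; have Gfx := aut_SI Gx.
  exists (cW false x), (cP false x), h; split=> //; first exact: WU.
    by have := congr1 (cW false) E; rewrite !WM' // Wg W0.
  have := congr1 (cP false) E; rewrite !PM' // Wg Pg P0 // => E1.
  by apply: (addrI (w * (a0 * tau0 (cP false x) + K0 (cW false x)))); rewrite E1; ring.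
(* When the corners are exchanged, the components of [x] at the second corner are expressed through
   those at the first and substituted. *)
exists (tau1 \o tau0 : {rmorphism R -> R}), (a1 * tau1 a0),
  (fun h => cW false h * tau1 (cW true h)),
  (fun w v h => v * cP false h - w * (K1 (tau0 v / cW true h)
     + a1 * tau1 (K0 v - tau0 v / cW true h * cP true h))).
split; [exact: bij_comp | by rewrite unitrM U1 rmorph_unit |].
move=> w r Uw; have [Gg Wg Pg Wg' Pg'] := celtP false r ng Uw.
set g := celt _ _ _ _ in Gg Wg Pg Wg' Pg'; rewrite /= in Wg' Pg'.
have [x [h [Gx hr Gh E]]] := covE g Gg; have Gfx := aut_SI Gx.
exists (cW false x), (cP false x), h; split=> //; first exact: WU.
  have := congr1 (cW true) E; rewrite !WM' // Wg' mul1r W0 // => E1.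
  have := congr1 (cW false) E; rewrite !WM' // Wg W1 // => E2.
  by rewrite /= E1 rmorphM [LHS]mulrA E2 mulrA.
have := congr1 (cW true) E; rewrite !WM' // Wg' mul1r W0 // => E1.
have := congr1 (cP true) E; rewrite !PM' // Wg' Pg' mul1r addr0 P0 // => E3.
have := congr1 (cP false) E; rewrite !PM' // Wg Pg P1 // => E4.
have E1' : cW true x = tau0 (cW false x) / cW true h by rewrite E1 mulrK // WU.
have E3' : cP true x = a0 * tau0 (cP false x)
    + (K0 (cW false x) - tau0 (cW false x) / cW true h * cP true h).
  by rewrite -E1' addrA E3; ring.
rewrite E3' E1' in E4; rewrite /= !rmorphD rmorphM in E4 *.
by apply: (addrI (w * (a1 * (tau1 a0 * tau1 (tau0 (cP false x))
   + tau1 (K0 (cW false x) - tau0 (cW false x) / cW true h * cP true h))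
   + K1 (tau0 (cW false x) / cW true h)))); rewrite rmorphD E4; ring.
Qed.
End Automorphism.

(** * Finite generation of the ring and the conclusion *)

Section RingGen.
Variables (R : nzRingType) (gs : seq R).

Lemma ring_gen0 : ring_gen gs 0.
Proof. by rewrite -(subrr 1); apply: ring_genB; apply: ring_gen1. Qed.

Lemma ring_genD x y : ring_gen gs x -> ring_gen gs y -> ring_gen gs (x + y).
Proof.
move=> gx gy; rewrite -[y]opprK -[- y]sub0r.
by apply: ring_genB => //; apply: ring_genB => //; apply: ring_gen0.
Qed.
End RingGen.

(** Entries of the generators and of their inverses generate [R], since every [r] is an entry of an
    elementary matrix in S. *)
Lemma SI_fin_gen_ring (R : idomainType) (n : nat) (I : {set 'I_n.+2}) :
  SI_fin_gen R I -> exists gs : seq R, forall r, ring_gen gs r.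
Proof.
case=> s [sG gens].
pose gs := [seq (A : 'M[R]_n.+2) p.1 p.2 | A <- s ++ map invmx s,
                                           p <- enum {: 'I_n.+2 * 'I_n.+2}].
have gs_mem A i j : A \in s ++ map invmx s -> ring_gen gs (A i j).
  move=> As; apply: ring_gen_mem; apply/allpairsP.
  by exists (A, (i, j)); rewrite /= mem_enum.
have mx1 i j : ring_gen gs ((1 : 'M[R]_n.+2) i j).
  by rewrite mxE; case: (i == j); [apply: ring_gen1 | apply: ring_gen0].
have mxM (A B : 'M[R]_n.+2) : (forall i j, ring_gen gs (A i j)) ->
    (forall i j, ring_gen gs (B i j)) -> forall i j, ring_gen gs ((A * B) i j).
  move=> gA gB i j; rewrite mxE.
  apply: (big_ind (ring_gen gs)) => [|x y|k _]; first exact: ring_gen0.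
    exact: ring_genD.
  exact: ring_genM.
have entries A : gen_by s A -> [/\ inSI I A, forall i j, ring_gen gs (A i j)
    & forall i j, ring_gen gs (A^-1 i j)].
  elim=> {A} [|A As|A B _ [GA gA gA'] _ [GB gB gB']|A _ [GA gA gA']].
  - split=> [|//|i j]; first exact: SI1.
    by rewrite invr1.
  - split=> [|i j|i j]; first exact: sG.
      by apply: gs_mem; rewrite mem_cat As.
    by apply: gs_mem; rewrite mem_cat map_f ?orbT.
  - split; [exact: SIM|exact: mxM|].
    by rewrite -[A *m B]/(A * B) invrM ?(SI_unit GA) ?(SI_unit GB) //; apply: mxM.
  - by rewrite -[invmx A]/(A^-1) invrK; split=> //; apply: SIV.
exists gs => r.
have lt01 : ((ord0 : 'I_n.+2) < @Ordinal n.+2 1 isT)%N by [].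
have [_ gr _] := entries _ (gens _ (SI_emx I r lt01)).
by have := gr ord0 (@Ordinal n.+2 1 isT); rewrite emx_ij.
Qed.

Lemma Fq_localization_infinitely_many_fixed (R : idomainType) (rho : {rmorphism R -> R}) :
  is_Fq_localization R -> bijective rho -> infinitely_many_fixed rho.
Proof.
case=> F [f [iota [[_ f_irr] _ iota_inj f_unit R_loc]]].
have irr g : g \in f -> irreducible_poly g by case/f_irr.
have [L [j j_root]] := common_root_extension (fun g gf => fst (irr g gf)).
exact: (localization_infinitely_many_fixed irr iota_inj f_unit R_loc j_root
  (finNzRing_gt1 L) (@expf_card L)).
Qed.

(** Such a unit separates the characters of the two corners: [-1] in characteristic zero, the image
    of an inverted polynomial otherwise. *)
Lemma exists_nontrivial_unit (R : idomainType) :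
  [pchar R] =i pred0 \/ is_Fq_localization R ->
  exists2 u : R, u \is a GRing.unit & u != 1.
Proof.
case=> [/pcharf0P ch0|[F [[|g f] [iota [[//= _ f_irr] _ iota_inj f_unit _]]]]].
  exists (-1); first by rewrite unitrN unitr1.
  by rewrite eq_sym -addr_eq0 -[1 + 1]/(2%:R) ch0.
exists (iota g); first by apply: f_unit; rewrite mem_head.
have [_ [sg _]] := f_irr g (mem_head _ _).
rewrite -(rmorph1 iota) (inj_eq iota_inj).
by apply: contraTneq sg => ->; rewrite size_poly1.
Qed.

Theorem theorem1p4 (R : idomainType) (n : nat) (I : {set 'I_n}) :
  (4 <= n)%N ->
  NG_condition I ->
  ([pchar R] =i pred0 \/ is_Fq_localization R) ->
  SI_fin_gen R I ->
  SI_R_infty R I.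
Proof.
case: n I => [|[|[|[|m]]]] // I _ ng Rcase fg phi aut_phi [reps [repsG cov]].
have [gs genR] := SI_fin_gen_ring fg.
have [u Uu u1] := exists_nontrivial_unit Rcase.
have [rho [a [v0 [C [bij Ua affcov]]]]] := aut_affine_cover aut_phi ng Uu u1 repsG cov.
have inf : infinitely_many_fixed rho.
  case: Rcase => [ch0|loc]; first exact: pchar0_infinitely_many_fixed.
  exact: Fq_localization_infinitely_many_fixed.
exact: (no_finite_affine_cover genR inf Ua affcov).
Qed.
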